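(* Let $G$ be any connected graph and let $U \subseteq V(G)$ be any vertex set. Then exactly one of the following two assertions holds: (i) $G$ contains a dominated comb attached to $U$; (ii) $G$ has a rooted tree-decomposition with upwards disjoint finite separators that displays the set of ends of $G$ lying in the closure of $U$. Moreover, if (ii) holds, the tree-decomposition in (ii) can be chosen with connected separators and so that it covers $U$ cofinally.
   Context: Graphs may be infinite. A comb is the union of a ray $R$ (its spine) with infinitely many disjoint finite paths, possibly trivial, having precisely their first vertex on $R$; their last vertices are the teeth; a comb attached to $U$ has all teeth in $U$. A subdivided star (subdivision of an infinite star) dominates a comb if infinitely many of its leaves are teeth of the comb; a dominated comb in $G$ is a comb in $G$ dominated by some subdivided star in $G$. An end of $G$ is an equivalence class of rays, two rays being equivalent if no finite vertex set separates them. An end $\omega$ lies in the closure of $U$ if $G$ contains a comb attached to $U$ with spine in $\omega$. For a tree-decomposition $(T,(V_t)_{t\in T})$ the separator associated with an edge $t_1t_2$ is $V_{t_1}\cap V_{t_2}$; it is connected if it induces a connected subgraph of $G$. In a rooted tree-decomposition (with root $r$ and tree-order $\le$ on $T$) the separators are upwards disjoint if for any two distinct edges $e,f$ of $T$ with $e$ on the path from $r$ to $f$ the associated separators are disjoint. If all separators are finite, each end $\omega$ of $G$ orients each edge $t_1t_2$ of $T$ towards that component of $T - t_1t_2$ whose parts (minus the separator) contain tails of the rays of $\omega$; either all edges point to a unique node $t$ ($\omega$ lives at $t$) or the orientations point to a unique end $\eta$ of $T$ ($\omega$ corresponds to $\eta$); write $\tau(\omega)$ for this node or end. The decomposition displays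 a set $\Psi$ of ends if $\tau$ restricts to a bijection from $\Psi$ onto the set of ends of $T$ and maps every end not in $\Psi$ to a node of $T$. A rooted tree-decomposition covers $U$ cofinally if every node of $T$ lies below (in the tree-order) some node whose part meets $U$.
   Formalization: The clause that the tree-decomposition covers U cofinally is claimed only for non-empty U; for empty U no part meets U while the tree has a root, so that clause is false as stated. *)

(* Defs.v *)
From mathcomp Require Export all_boot.
From mathcomp Require Export boolp classical_sets functions cardinality.

Set Implicit Arguments.
Unset Strict Implicit.
Unset Printing Implicit Defensive.

Local Open Scope classical_set_scope.

(* Possibly infinite simple graphs.  The boolean adjacency and the eqType only
   give access to [path] and [uniq]: classically every type is an eqType and
   every relation is boolean. *)
Record graph := Graph {
  vertex :> eqType;
  adj : rel vertex;
  adj_sym : symmetric adj;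
  adj_irrefl : irreflexive adj
}.
Arguments adj : clear implicits.

(* A finite path is the nonempty sequence of its vertices, given by its first
   vertex x and the sequence p of the others; p = [::] is the trivial path. *)
Definition is_path (G : graph) (x : G) (p : seq G) : bool :=
  path (adj G) x p && uniq (x :: p).

Definition path_vertices (G : graph) (q : G * seq G) : set G :=
  [set` q.1 :: q.2].

Definition path_end (G : graph) (q : G * seq G) : G := last q.1 q.2.

(* As usual for graphs, the empty vertex set is not connected. *)
Definition connected_in (G : graph) (A : set G) : Prop :=
  A !=set0 /\
  forall x y : G, A x -> A y ->
    exists p : seq G,
      [/\ is_path x p, last x p = y & path_vertices (x, p) `<=` A].

Definition connected_graph (G : graph) : Prop := connected_in [set: G].

(* [x :: p] is a cycle when it is a path on at least three vertices whose last
   vertex is adjacent to the first. *)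
Definition acyclic (G : graph) : Prop :=
  forall (x : G) (p : seq G),
    is_path x p -> (2 <= size p)%N -> ~~ adj G (last x p) x.

Definition is_tree (T : graph) : Prop := connected_graph T /\ acyclic T.

Definition is_ray (G : graph) (R : nat -> G) : Prop :=
  injective R /\ forall n, adj G (R n) (R n.+1).

Definition separates (G : graph) (X A B : set G) : Prop :=
  forall (x : G) (p : seq G), is_path x p -> A x -> B (last x p) ->
    path_vertices (x, p) `&` X !=set0.

Definition ray_equiv (G : graph) (R S : nat -> G) : Prop :=
  forall X : set G, finite_set X -> ~ separates X (range R) (range S).

Definition ends (G : graph) : set (set (nat -> G)) :=
  [set w | exists2 R, is_ray R & w = [set S | is_ray S /\ ray_equiv R S]].

Arguments ends : clear implicits.

(* Every path in P starts on the spine R, so P is automatically countable. *)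
Definition is_comb (G : graph) (R : nat -> G) (P : set (G * seq G)) : Prop :=
  [/\ is_ray R,
      infinite_set P,
      forall q, P q -> is_path q.1 q.2,
      forall q, P q -> path_vertices q `&` range R = [set q.1]
    & trivIset P (@path_vertices G)].

Definition teeth (G : graph) (P : set (G * seq G)) : set G :=
  [set path_end q | q in P].

(* A subdivided star with centre c: each p in L lists the vertices other than c
   of the path replacing an edge of the star. *)
Definition is_star (G : graph) (c : G) (L : set (seq G)) : Prop :=
  [/\ infinite_set L,
      forall p, L p -> p != [::] /\ is_path c p
    & trivIset L (fun p => [set` p])].

Definition leaves (G : graph) (c : G) (L : set (seq G)) : set G :=
  [set last c p | p in L].

Definition comb_attached (G : graph) (U : set G)
    (R : nat -> G) (P : set (G * seq G)) : Prop :=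
  is_comb R P /\ teeth P `<=` U.

Definition has_dominated_comb (G : graph) (U : set G) : Prop :=
  exists (R : nat -> G) (P : set (G * seq G)),
    comb_attached U R P /\
    exists (c : G) (L : set (seq G)),
      is_star c L /\ infinite_set (leaves c L `&` teeth P).

Definition ends_in_closure (G : graph) (U : set G) : set (set (nat -> G)) :=
  [set w | ends G w /\ exists R P, comb_attached U R P /\ w R].

(* z lies on a path from x to y; used in trees, where this path is unique. *)
Definition on_path (G : graph) (x y z : G) : Prop :=
  exists p : seq G, [/\ is_path x p, last x p = y & z \in x :: p].

Record rooted_tree_decomposition (G : graph) := RootedTreeDecomposition {
  td_tree :> graph;
  td_root : td_tree;
  td_part : td_tree -> set G;
  td_is_tree : is_tree td_tree;
  td_cover_vertex : forall v, exists t, td_part t v;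
  td_cover_edge : forall u v, adj G u v ->
    exists t, td_part t u /\ td_part t v;
  td_convex : forall t1 t2 t3, on_path t1 t3 t2 ->
    td_part t1 `&` td_part t3 `<=` td_part t2
}.
Arguments td_root {G} D : rename.
Arguments td_part {G} D t : rename.

Section TreeDecomposition.
Variables (G : graph) (D : rooted_tree_decomposition G).

Definition tree_le (s t : D) : Prop := on_path (td_root D) t s.

Definition separator (s t : D) : set G := td_part D s `&` td_part D t.

Definition finite_separators : Prop :=
  forall s t : D, adj D s t -> finite_set (separator s t).

Definition connected_separators : Prop :=
  forall s t : D, adj D s t -> connected_in (separator s t).

(* The edge ab lies on the path from the root to the edge cd exactly when both
   a and b lie on the path from the root to an endvertex of cd; since c and d
   can be exchanged, it suffices to name that endvertex c. *)
Definition upwards_disjoint_separators : Prop :=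
  forall a b c d : D, adj D a b -> adj D c d ->
    (a, b) != (c, d) -> (a, b) != (d, c) ->
    tree_le a c -> tree_le b c ->
    separator a b `&` separator c d = set0.

(* The node set of the component of T - st that contains t. *)
Definition side (s t : D) : set D :=
  [set u | exists p : seq D,
     path [rel x y | adj D x y && ((x, y) \notin [:: (s, t); (t, s)])] t p
     /\ last t p = u].

Definition has_tail_in (H : graph) (R : nat -> H) (A : set H) : Prop :=
  exists N, forall n, (N <= n)%N -> A (R n).

(* w orients the edge st of the decomposition tree from s towards t. *)
Definition orients (w : set (nat -> G)) (s t : D) : Prop :=
  forall R, w R ->
    has_tail_in R ((\bigcup_(u in side s t) td_part D u) `\` separator s t).

Definition lives_at (w : set (nat -> G)) (t : D) : Prop :=
  forall x y : D, adj D x y -> side x y t -> orients w x y.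

Definition corresponds_to (w : set (nat -> G)) (h : set (nat -> D)) : Prop :=
  ends D h /\
  forall x y : D, adj D x y -> (forall S, h S -> has_tail_in S (side x y)) ->
    orients w x y.

(* When all separators are finite, this determines tau on the ends of G. *)
Definition is_tau (tau : set (nat -> G) -> D + set (nat -> D)) : Prop :=
  forall w, ends G w ->
    match tau w with
    | inl t => lives_at w t
    | inr h => corresponds_to w h
    end.

Definition displays (Psi : set (set (nat -> G))) : Prop :=
  exists tau : set (nat -> G) -> D + set (nat -> D),
    [/\ is_tau tau,
        set_bij Psi [set inr h | h in ends D] tau
      & forall w, ends G w -> ~ Psi w -> exists t, tau w = inl t].

Definition covers_cofinally (U : set G) : Prop :=
  forall t : D, exists2 t', tree_le t t' & td_part D t' `&` U !=set0.

End TreeDecomposition.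

Definition displaying_decomposition (G : graph) (U : set G)
    (D : rooted_tree_decomposition G) : Prop :=
  [/\ finite_separators D,
      upwards_disjoint_separators D
    & displays D (ends_in_closure U)].

(* Main.v *)
Require Import Defs.
From mathcomp Require Import zify.

(* Exclusiveness: an end displayed at a ray of the decomposition tree is cut off
   by infinitely many finite separators, and upwards disjointness lets each
   vertex lie in at most one of them far out along the ray, so no vertex
   dominates the end.

   Existence: suppose there is no dominated comb attached to U. Given a
   connected set C and a finite set X, delete finite sets from C one after the
   other, setting aside every component that avoids U or sends no edge to X. If
   this did not stop along every branch, it would yield disjoint connected sets
   F_0, F_1, ..., each joined to the next by an edge, each containing a vertex of
   U and a neighbour of X. A ray through all F_n gives a comb attached to U, and
   as X is finite, infinitely many F_n contain a neighbour of the same x in X,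
   which is then the centre of a star dominating that comb. So the process stops
   along every branch, and each end in the closure of U that lives in C lives in
   a component set aside which meets U and whose finite neighbourhood avoids X.
   Iterating this, with X a finite connected set containing the neighbourhood
   of C, gives the decomposition tree: the neighbourhoods of the successive
   components are extended to disjoint finite connected separators. *)

Set Implicit Arguments.
Unset Strict Implicit.
Unset Printing Implicit Defensive.

Local Open Scope classical_set_scope.

(** * Walks, components and rays *)

Section Walks.
Variable G : graph.
Implicit Types (A B C X : set G) (x y z : G).

(** Walks need not be paths, so concatenating them requires no shortening; [connP] recovers a path
    where one is called for. *)
Definition conn A x y :=
  exists p, [/\ path (adj G) x p, last x p = y & [set` x :: p] `<=` A].

Lemma conn_refl A x : A x -> conn A x x.
Proof. by move=> Ax; exists [::]; split=> // z /=; rewrite inE => /eqP->. Qed.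

Lemma conn_step A x y z : A x -> adj G x y -> conn A y z -> conn A x z.
Proof.
move=> Ax xy [p [yp <- pA]]; exists (y :: p); split=> //=; first by rewrite xy.
by move=> t /=; rewrite inE => /predU1P[->//|/pA].
Qed.

Lemma conn_inv A x y (Q : set G) :
  (forall u v, A u -> A v -> adj G u v -> Q u -> Q v) ->
  conn A x y -> Q x -> Q y.
Proof.
move=> AQ [p [+ <- +]]; elim: p x => //= u p IH x /andP[xu up] pA Qx.
apply: IH => //; first by move=> t tp; apply: pA; rewrite /= inE tp orbT.
by apply: AQ xu Qx; apply: pA; rewrite /= !inE eqxx ?orbT.
Qed.

Lemma conn_l A x y : conn A x y -> A x.
Proof. by move=> [p [_ _]]; apply; rewrite /= mem_head. Qed.

Lemma conn_r A x y : conn A x y -> A y.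
Proof. by move=> c; apply: conn_inv (c) (conn_l c). Qed.

Lemma conn_trans A x y z : conn A x y -> conn A y z -> conn A x z.
Proof.
move=> [p [xp <- pA]] [q [yq <- qA]]; exists (p ++ q).
split; rewrite ?cat_path ?xp ?last_cat// => t /=; rewrite inE mem_cat orbA.
by case/orP=> tp; [apply: pA | apply: qA]; rewrite /= inE ?tp ?orbT.
Qed.

Lemma conn_edge A x y : A x -> A y -> adj G x y -> conn A x y.
Proof. by move=> Ax Ay xy; apply: conn_step xy (conn_refl Ay). Qed.

Lemma conn_sym A x y : conn A x y -> conn A y x.
Proof.
move=> c; apply: (conn_inv (Q := conn A ^~ x)) (c) (conn_refl (conn_l c)).
by move=> u v Au Av uv; apply: conn_step Av _; rewrite adj_sym.
Qed.

Lemma conn_sub A B x y : A `<=` B -> conn A x y -> conn B x y.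
Proof. by move=> AB [p [xp l pA]]; exists p; split=> // t /pA/AB. Qed.

Lemma connP A x y : conn A x y <->
  exists p, [/\ is_path x p, last x p = y & path_vertices (x, p) `<=` A].
Proof.
split=> [[p [xp <- pA]]|[p [/andP[xp _] l pA]]]; last by exists p.
case: (shortenP xp) pA => q xq uq qp pA.
exists q; split=> //; first by rewrite /is_path xq uq.
move=> t; rewrite /path_vertices/= inE => /predU1P[->|tq].
  by apply: pA; rewrite /= mem_head.
by apply: pA; rewrite /= inE (qp _ tq) orbT.
Qed.

Lemma connected_inP A :
  connected_in A <-> A !=set0 /\ forall x y, A x -> A y -> conn A x y.
Proof. by split=> -[A0 cA]; split=> // x y Ax Ay; apply/connP; apply: cA. Qed.

Definition nbh A := [set v | ~ A v /\ exists2 w, A w & adj G w v].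

Lemma conn_nbh A C x y :
  (forall z, A z -> ~ nbh C z) -> conn A x y -> C x -> C y.
Proof.
move=> AC; apply: conn_inv => u v Au Av uv Cu; apply: contrapT => nCv.
by apply: (AC v Av); split=> //; exists u.
Qed.

Lemma conn_meets_nbh A C x y :
  conn A x y -> ~ C x -> C y -> exists2 z, A z & nbh C z.
Proof.
move=> /conn_sym cA nCx Cy; apply: contrapT => nz; apply: nCx.
by apply: conn_nbh cA Cy => z Az Cz; apply: nz; exists z.
Qed.

(** Unite walks in [A] from one fixed vertex of [A] to the members of [F]. The fixed vertex keeps
    [X] nonempty even if [F] is empty. *)
Lemma connected_hull A F : connected_in A -> F `<=` A -> finite_set F ->
  exists X, [/\ finite_set X, connected_in X, F `<=` X & X `<=` A].
Proof.
move=> /connected_inP[[a Aa] cA] + /finite_seqP[s Fs]; rewrite {}Fs => sA.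
suff [X [fX Xa XA sX cX]] : exists X,
    [/\ finite_set X, X a, X `<=` A, [set` s] `<=` X &
        forall x, X x -> conn X a x].
  exists X; split=> //; apply/connected_inP; split; first by exists a.
  by move=> x y Xx Xy; apply: conn_trans (cX y Xy); apply/conn_sym/cX.
elim: s sA => [_|b s IH sA].
  exists [set a]; split=> //; first by move=> x ->.
  by move=> x ->; apply: conn_refl.
have [|X [fX Xa XA sX cX]] := IH.
  by move=> t ts; apply: sA; rewrite /= inE [X in _ || X]ts orbT.
have [|p [ap lp pA]] := cA a b Aa; first by apply: sA; rewrite /= mem_head.
exists (X `|` [set` a :: p]); split.
- by rewrite finite_setU; split=> //; exact: finite_seq.
- by left.
- by move=> x [/XA|/pA].
- move=> x; rewrite /= inE => /predU1P[->|/sX]; last by left.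
  by right; rewrite /= -lp mem_last.
- move=> x [Xx|]; first by apply: conn_sub (cX x Xx) => t; left.
  move=> xp; have : conn [set` a :: p] a x; last first.
    by apply: conn_sub => t; right.
  case/splitPl: p / xp {lp pA} ap => p1 p2 lp1; rewrite cat_path => /andP[ap1 _].
  by exists p1; split=> // t; rewrite /= !inE mem_cat orbA => ->.
Qed.

Definition comp A x := [set y | conn A x y].

Lemma comp_sub A x : comp A x `<=` A.
Proof. by move=> y /conn_r. Qed.

Lemma comp_connected A x : A x -> connected_in (comp A x).
Proof.
move=> Ax; have cx y : conn A x y -> conn (comp A x) x y.
  have xx : conn (comp A x) x x by exact/conn_refl/conn_refl.
  move=> c; apply: conn_inv (c) xx => u v Au Av uv xu.
  apply: conn_trans (xu) (conn_edge (conn_r xu) _ uv).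
  exact: conn_trans (conn_r xu) (conn_edge Au Av uv).
apply/connected_inP; split; first by exists x; apply: conn_refl.
by move=> y z /cx/conn_sym xy /cx xz; apply: conn_trans xy xz.
Qed.

Lemma nbh_comp A x : nbh (comp A x) `<=` ~` A.
Proof.
move=> y [ny [z xz zy]] Ay; apply: ny; apply: conn_trans (xz) _.
exact: conn_edge (conn_r xz) Ay zy.
Qed.

End Walks.

(** * Rays, ends and sets with finite neighbourhood *)

Section Rays.
Variable G : graph.
Implicit Types (R S : nat -> G) (A C X : set G).

Lemma has_tail_sub R A C : A `<=` C -> has_tail_in R A -> has_tail_in R C.
Proof. by move=> AC [N RA]; exists N => n /RA/AC. Qed.

Lemma has_tailI R A C :
  has_tail_in R A -> has_tail_in R C -> has_tail_in R (A `&` C).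
Proof.
move=> [M RA] [N RC]; exists (maxn M N) => n; rewrite geq_max => /andP[Mn Nn].
by split; [apply: RA | apply: RC].
Qed.

Lemma has_tail_nonempty R A : has_tail_in R A -> exists n, A (R n).
Proof. by move=> [N RA]; exists N; apply: RA. Qed.

Lemma ray_avoids_finite R X : is_ray R -> finite_set X -> has_tail_in R (~` X).
Proof.
move=> [Rinj _] /finite_seqP[s ->]; elim: s => [|a s [N IH]].
  by exists 0%N => n _ /=; rewrite in_nil.
have [[k Rk]|nk] := pselect (exists k, R k = a).
  exists (maxn N k.+1) => n; rewrite geq_max => /andP[Nn kn] /=.
  rewrite inE => /predU1P[Rn|]; last exact: IH.
  by move: kn; rewrite (Rinj n k) ?ltnn// Rn.
exists N => n Nn /=; rewrite inE => /predU1P[Rn|]; last exact: IH.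
by apply: nk; exists n.
Qed.

Lemma ray_conn R A N m n : is_ray R -> (forall k, (N <= k)%N -> A (R k)) ->
  (N <= m)%N -> (N <= n)%N -> conn A (R m) (R n).
Proof.
move=> [_ Radj] RA Nm Nn; wlog mn : m n Nm Nn / (m <= n)%N.
  move=> W; have [mn|nm] := leqP m n; first exact: W.
  by apply/conn_sym/W => //; apply: ltnW.
elim: n mn {Nn} => [|n IH]; rewrite ?leqn0; first by move/eqP=> <-; apply/conn_refl/RA.
rewrite leq_eqVlt => /predU1P[<-|mn]; first exact/conn_refl/RA.
apply: conn_trans (IH mn) _; apply: conn_edge; rewrite ?Radj//; apply: RA; lia.
Qed.

(** A tail of [R] avoids the finite set [nbh C], and a walk avoiding [nbh C] can never leave [C]. *)
Lemma ray_dichotomy R C : is_ray R -> finite_set (nbh C) ->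
  has_tail_in R C \/ has_tail_in R (~` C).
Proof.
move=> Rray /(ray_avoids_finite Rray)[N RN].
have [RC|nRC] := pselect (exists2 n, (N <= n)%N & C (R n)).
  left; case: RC => n Nn CRn; exists n => m nm.
  apply: (conn_nbh (A := ~` nbh C) (x := R n)) => //.
  by apply: ray_conn RN _ _ => //; apply: leq_trans nm.
by right; exists N => n Nn CRn; apply: nRC; exists n.
Qed.

Lemma ray_equivP R S : ray_equiv R S <->
  forall X, finite_set X -> exists m n, conn (~` X) (R m) (S n).
Proof.
split=> RS X fX; last first.
  move=> sep; have [m [n /connP[p [Rp lp pX]]]] := RS X fX.
  have [||z [/pX]//] := sep (R m) p Rp; first by exists m.
  by rewrite lp; exists n.
apply: contrapT => nc; apply: (RS X fX) => x p xp [m _ mx] [n _ nx].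
apply: contrapT => px; apply: nc; exists m, n; apply/connP; exists p.
rewrite mx nx; split=> // t tp Xt; apply: px; by exists t.
Qed.

Lemma ray_equiv_refl R : is_ray R -> ray_equiv R R.
Proof.
move=> Rray; apply/ray_equivP => X /(ray_avoids_finite Rray)[N RN].
by exists N, N; apply/conn_refl/RN.
Qed.

Lemma ray_equiv_sym R S : ray_equiv R S -> ray_equiv S R.
Proof.
move/ray_equivP => RS; apply/ray_equivP => X /RS[m [n c]].
by exists n, m; apply: conn_sym.
Qed.

Lemma ray_equiv_trans R S Q : is_ray S ->
  ray_equiv R S -> ray_equiv S Q -> ray_equiv R Q.
Proof.
move=> Sray /ray_equivP RS /ray_equivP SQ; apply/ray_equivP => X fX.
have [N SN] := ray_avoids_finite Sray fX.
(* Adding the start of [S] to [X] forces both walks to meet [S] in its tail outside [X], along which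
   they can be joined. *)
pose Y := X `|` [set S k | k in `I_N].
have fY : finite_set Y.
  by rewrite finite_setU; split=> //; apply/finite_image/finite_II.
have YX : ~` Y `<=` ~` X by move=> x nY Xx; apply: nY; left.
have SY k : ~ Y (S k) -> (N <= k)%N.
  by move=> nY; rewrite leqNgt; apply/negP => kN; apply: nY; right; exists k.
have [m [n c1]] := RS Y fY; have [n' [k c2]] := SQ Y fY.
exists m, k; apply: conn_trans (conn_sub YX c1) _.
apply: conn_trans (conn_sub YX c2); apply: ray_conn SN _ _ => //.
  exact: SY (conn_r c1).
exact: SY (conn_l c2).
Qed.

Lemma ray_equiv_tail R S C : is_ray R -> is_ray S -> finite_set (nbh C) ->
  ray_equiv R S -> has_tail_in R C -> has_tail_in S C.
Proof.
move=> Rray Sray fC /ray_equivP RS [N RC].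
have [//|[M SC]] := ray_dichotomy Sray fC.
(* With both initial segments removed, a walk between the rays starts inside [C] and ends outside
   it. *)
pose X := nbh C `|` [set R k | k in `I_N] `|` [set S k | k in `I_M].
have fX : finite_set X.
  by rewrite !finite_setU; do !split=> //; apply/finite_image/finite_II.
have [m [n c]] := RS X fX.
have Nm : (N <= m)%N.
  rewrite leqNgt; apply/negP => mN; apply: (conn_l c).
  by left; right; exists m.
have Mn : (M <= n)%N.
  rewrite leqNgt; apply/negP => nM; apply: (conn_r c).
  by right; exists n.
case: (SC n Mn); apply: conn_nbh c (RC m Nm) => z nXz Cz.
by apply: nXz; left; left.
Qed.

Lemma end_ray (w : set (nat -> G)) R : ends G w -> w R -> is_ray R.
Proof. by move=> [S _ ->] []. Qed.

Lemma end_inhabited (w : set (nat -> G)) : ends G w -> exists R, w R.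
Proof. by move=> [R Rray ->]; exists R; split=> //; apply: ray_equiv_refl. Qed.

Lemma end_equiv (w : set (nat -> G)) R S : ends G w -> w R -> w S -> ray_equiv R S.
Proof.
move=> [Q Qray ->] [_ QR] [_ QS].
exact: ray_equiv_trans Qray (ray_equiv_sym QR) QS.
Qed.

Lemma end_of_ray R : is_ray R -> ends G [set S | is_ray S /\ ray_equiv R S].
Proof. by move=> Rray; exists R. Qed.

Lemma end_eq (w w' : set (nat -> G)) R S : ends G w -> ends G w' -> w R -> w' S ->
  ray_equiv R S -> w = w'.
Proof.
have sub (v v' : set (nat -> G)) Q Q' : ends G v -> ends G v' -> v Q -> v' Q' ->
    ray_equiv Q Q' -> v `<=` v'.
  move=> vE [P' P'ray ->] vQ [Q'ray P'Q'] QQ' P vP.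
  have Pray := end_ray vE vP; split=> //.
  apply: (ray_equiv_trans Q'ray P'Q').
  apply: (ray_equiv_trans (end_ray vE vQ) (ray_equiv_sym QQ')).
  exact: end_equiv vE vQ vP.
move=> wE w'E wR w'S RS; apply/seteqP; split; first exact: sub RS.
by apply: sub (ray_equiv_sym RS).
Qed.

Lemma end_tail (w : set (nat -> G)) R S C : ends G w -> w R -> w S ->
  finite_set (nbh C) -> has_tail_in R C -> has_tail_in S C.
Proof.
move=> wE wR wS fC; apply: ray_equiv_tail => //; last exact: end_equiv wE wR wS.
  exact: end_ray wE wR.
exact: end_ray wE wS.
Qed.

End Rays.

(** * Combs along sequences of connected blocks *)

Lemma infinite_range (T : Type) (f : nat -> T) :
  injective f -> infinite_set (range f).
Proof.
move=> finj /(finite_preimage (in2W finj)); rewrite preimage_range.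
exact: infinite_nat.
Qed.

Section Combs.
Variable G : graph.

(** The ray is the limit of the paths: [V k] is long enough to supply vertex number [k], and longer
    paths agree with it there. *)
Lemma ray_of_nested_paths (x : G) (V : nat -> seq G) :
  (forall n, path (adj G) x (V n)) -> (forall n, uniq (x :: V n)) ->
  (forall n, (n <= size (V n))%N) -> (forall n, exists t, V n.+1 = V n ++ t) ->
  exists R, is_ray R /\
    forall n k, (k <= size (V n))%N -> R k = nth x (x :: V n) k.
Proof.
move=> Vp Vu Vs Vt; pose R k := nth x (x :: V k) k.
have Vmn m n : (m <= n)%N -> exists t, V n = V m ++ t.
  elim: n => [|n IH]; first by rewrite leqn0 => /eqP->; exists [::]; rewrite cats0.
  rewrite leq_eqVlt => /predU1P[->|/IH[t Vn]]; first by exists [::]; rewrite cats0.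
  by have [t' ->] := Vt n; exists (t ++ t'); rewrite Vn catA.
have RV n k : (k <= size (V n))%N -> R k = nth x (x :: V n) k.
  move=> kn; rewrite /R; have [/Vmn[t ->]|/ltnW/Vmn[t Vk]] := leqP k n.
    by rewrite -cat_cons nth_cat /= ltnS Vs.
  by rewrite Vk -cat_cons nth_cat /= ltnS kn.
exists R; split=> //; split=> [i j|k].
  have leV m n : (m <= n)%N -> (m <= size (V n))%N.
    by move=> mn; apply: leq_trans mn (Vs n).
  rewrite (RV (maxn i j) i) ?leV ?leq_maxl// (RV (maxn i j) j) ?leV ?leq_maxr//.
  by move/eqP; rewrite nth_uniq ?Vu//= ?ltnS ?leV ?leq_maxl ?leq_maxr// => /eqP.
rewrite (RV k.+1 k) ?(RV k.+1 k.+1)//; last exact: leq_trans (Vs _).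
by have /(pathP x) := Vp k.+1; apply; apply: Vs.
Qed.

Lemma split_last_in (T : eqType) (B : set T) (s : seq T) :
  (exists2 t, t \in s & B t) ->
  exists s1 z s2, [/\ s = s1 ++ z :: s2, B z & forall t, t \in s2 -> ~ B t].
Proof.
elim: s => [[]//|a s IH] [t ts Bt].
have [/IH[s1 [z [s2 [-> Bz nB]]]]|nB] := pselect (exists2 t, t \in s & B t).
  by exists (a :: s1), z, s2.
exists [::], a, s; split=> //; last by move=> v vs Bv; apply: nB; exists v.
by move: ts; rewrite inE => /predU1P[<-//|ts]; case: nB; exists t.
Qed.

(** The path is cut at its last vertex in [B]; with [B] the spine, this gives the paths of a
    comb. *)
Lemma conn_last_in (A B : set G) x y : conn A x y -> B x ->
  exists z p, [/\ is_path z p, last z p = y, path_vertices (z, p) `<=` A &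
    path_vertices (z, p) `&` B = [set z]].
Proof.
move=> /connP[p [/andP[xp up] lp pA]] Bx.
have [|s1 [z [s2 [E Bz nB]]]] := @split_last_in _ B (x :: p).
  by exists x; rewrite ?mem_head.
exists z, s2; split.
- move: up; rewrite E cat_uniq => /and3P[_ _ us]; rewrite /is_path us andbT.
  case: s1 E => [[<- <-]//|a s1 [_ E]].
  by move: xp; rewrite E cat_path /= => /and3P[].
- by rewrite -lp -(last_cons x x p) E last_cat.
- by move=> t ts; apply: pA; rewrite /path_vertices /= E mem_cat [X in _ || X]ts orbT.
- apply/seteqP; split=> t; last first.
    by move=> ->; split=> //; rewrite /path_vertices /= mem_head.
  by rewrite /path_vertices /= inE => -[/predU1P[//|/nB]].
Qed.

(** Paths through successive blocks, linked by the edges between them, form the spine. Inside each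
    block a path leads from the spine to the prescribed tooth, and disjointness of the blocks keeps
    these paths apart. *)
Lemma comb_of_blocks (F : nat -> set G) (u : nat -> G) :
  (forall n, connected_in (F n)) ->
  (forall m n x, F m x -> F n x -> m = n) ->
  (forall n, exists x y, [/\ F n x, F n.+1 y & adj G x y]) ->
  (forall n, F n (u n)) ->
  exists R P, [/\ is_comb R P, teeth P = range u &
    forall n, has_tail_in R (\bigcup_(m in [set m | (n <= m)%N]) F m)].
Proof.
move=> cF dF aF Fu.
have cFP n : forall x y, F n x -> F n y -> conn (F n) x y.
  by case/connected_inP: (cF n).
have /choice[e eP] : forall n, exists e, [/\ F n e.1, F n.+1 e.2 & adj G e.1 e.2].
  by move=> n; have [x [y H]] := aF n; exists (x, y).
(* The vertex at which the spine enters a block. Block 0 is not entered from another one, so the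
   spine starts at its exit vertex. *)
pose a n := if n is m.+1 then (e m).2 else (e 0%N).1.
have Fa n : F n (a n) by case: n => [|n] /=; [case: (eP 0%N) | case: (eP n)].
have /choice[p pP] n : exists p, [/\ is_path (a n) p, last (a n) p = (e n).1
    & path_vertices (a n, p) `<=` F n].
  by apply/connP/cFP => //; case: (eP n).
pose V n := p 0%N ++ flatten (mkseq (fun i => a i.+1 :: p i.+1) n).
have VS n : V n.+1 = V n ++ a n.+1 :: p n.+1.
  by rewrite /V mkseqS flatten_rcons catA.
have V0 : V 0%N = p 0%N by rewrite /V /= cats0.
have Vlast n : last (a 0%N) (V n) = (e n).1.
  case: n => [|n]; first by rewrite V0; case: (pP 0%N).
  by rewrite VS last_cat /=; case: (pP n.+1).
have VF n x : x \in a 0%N :: V n -> exists2 i, (i <= n)%N & F i x.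
  elim: n => [|n IH]; first by rewrite V0; case: (pP 0%N) => _ _ pF /pF; exists 0%N.
  rewrite VS -cat_cons mem_cat => /orP[/IH[i ni Fi]|].
    by exists i => //; apply: leqW.
  by case: (pP n.+1) => _ _ pF /pF; exists n.+1.
have Vpath n : path (adj G) (a 0%N) (V n).
  elim: n => [|n IH]; first by rewrite V0; case: (pP 0%N) => /andP[].
  rewrite VS cat_path IH Vlast /=; case: (eP n) => _ _ ->.
  by case: (pP n.+1) => /andP[].
have Vuniq n : uniq (a 0%N :: V n).
  elim: n => [|n IH]; first by rewrite V0; case: (pP 0%N) => /andP[].
  rewrite VS -cat_cons cat_uniq IH andTb; case: (pP n.+1) => /andP[_ ->] _ pF.
  rewrite andbT; apply/hasPn => x /pF Fx; apply/negP => /VF[i ni Fi].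
  by move: ni; rewrite (dF i n.+1 x) ?ltnn.
have Vsize n : (n <= size (V n))%N.
  elim: n => [//|n IH]; rewrite VS size_cat /=; lia.
have Vtail n k : (n <= k)%N ->
    exists2 t, V k = V n ++ t & forall x, x \in t -> exists2 i, (n < i)%N & F i x.
  elim: k => [|k IH]; first by rewrite leqn0 => /eqP->; exists [::]; rewrite ?cats0.
  rewrite leq_eqVlt ltnS => /predU1P[->|nk]; first by exists [::]; rewrite ?cats0.
  have [t Vk tF] := IH nk; exists (t ++ a k.+1 :: p k.+1); first by rewrite VS Vk catA.
  move=> x; rewrite mem_cat => /orP[/tF//|].
  by case: (pP k.+1) => _ _ pF /pF; exists k.+1.
have [|R [Rray RV]] := ray_of_nested_paths Vpath Vuniq Vsize.
  by move=> n; exists (a n.+1 :: p n.+1).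
have Ra n : range R (a n).
  case: n => [|n]; first by exists 0%N => //; rewrite (RV 0%N 0%N).
  exists (size (V n)).+1 => //; rewrite (RV n.+1).
    by rewrite VS -cat_cons nth_cat /= ltnn subnn.
  by rewrite VS size_cat /= addnS ltnS leq_addr.
have /choice[q qP] n : exists q : G * seq G, [/\ is_path q.1 q.2, path_end q = u n,
    path_vertices q `<=` F n & path_vertices q `&` range R = [set q.1]].
  have [z [s H]] := conn_last_in (cFP n _ _ (Fa n) (Fu n)) (Ra n).
  by exists (z, s).
have qF n : path_vertices (q n) `<=` F n by case: (qP n).
have qq m n : path_vertices (q m) `&` path_vertices (q n) !=set0 -> m = n.
  by move=> [x [/qF + /qF]]; apply: dF.
exists R, (range q); split.
- split=> //.
  + have qinj : injective q.
      move=> m n qmn; apply: qq; rewrite qmn setIid.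
      by exists (q n).1; rewrite /path_vertices /= mem_head.
    exact: infinite_range.
  + by move=> _ [n _ <-]; case: (qP n).
  + by move=> _ [n _ <-]; case: (qP n).
  + by move=> _ _ [m _ <-] [n _ <-] /qq->.
- apply/seteqP; split=> x.
    by move=> [_ [n _ <-] <-]; exists n => //; case: (qP n).
  by move=> [n _ <-]; exists (q n); [exists n | case: (qP n)].
- move=> n; exists (size (V n)).+1 => k nk.
  have [|t Vk tF] := Vtail n k; first by have := Vsize n; lia.
  have kt : (k - (size (V n)).+1 < size t)%N.
    by have := Vsize k; rewrite Vk size_cat; lia.
  have : R k \in t.
    rewrite (RV k) // Vk -cat_cons nth_cat /= ltnNge nk /=; exact: mem_nth.
  by move=> /tF[i ni Fi]; exists i => //=; apply: ltnW.
Qed.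
End Combs.

(** * Displayed ends are undominated *)

Lemma trivIset_finite_meet (I T : Type) (P : set I) (F : I -> set T) (Y : set T) :
  trivIset P F -> finite_set Y ->
  finite_set [set i | P i /\ F i `&` Y !=set0].
Proof.
move=> tP; pose T' := {classic T}; move=> /(@finite_seqP T')[s Ys].
have {Ys} : Y `<=` [set y | y \in s] by rewrite Ys.
elim: s Y => [|a s IH] Y Ys.
  by apply: sub_finite_set (finite_set0 I) => i [_ [x [_ /Ys]]]; rewrite /= in_nil.
have fB := IH _ (fun x (h : [set y | y \in s] x) => h).
have fA : finite_set [set i | P i /\ F i a].
  have [[i [Pi Fi]]|nA] := pselect (exists i, P i /\ F i a); last first.
    by apply: sub_finite_set (finite_set0 I) => i ?; apply: nA; exists i.
  apply: sub_finite_set (finite_set1 i) => j [Pj Fj].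
  by apply: tP => //; exists a.
apply: sub_finite_set (_ : finite_set ([set i | P i /\ F i a] `|`
  [set i | P i /\ F i `&` [set y | y \in s] !=set0])); last by rewrite finite_setU.
move=> i [Pi [x [Fx /Ys /=]]]; rewrite inE => /predU1P[<-|xs]; first by left.
by right; split=> //; exists x.
Qed.

Section Domination.
Variable G : graph.

(** All but finitely many of the disjoint paths avoid [nbh B] and the spine before its tail in [B];
    such a path starts in [B] and cannot leave it. *)
Lemma comb_teeth_almost_in (R : nat -> G) P (B : set G) :
  is_comb R P -> finite_set (nbh B) -> has_tail_in R B ->
  finite_set [set q | P q /\ ~ B (path_end q)].
Proof.
move=> [Rray _ Ppath PR tP] fB [N RB].
pose Y := nbh B `|` [set R k | k in `I_N].
have fY : finite_set Y.
  by rewrite finite_setU; split=> //; apply/finite_image/finite_II.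
apply: sub_finite_set (trivIset_finite_meet tP fY) => q [Pq nBq]; split=> //.
apply: contrapT => nY; apply: nBq.
have [qR qR1] : (path_vertices q `&` range R) q.1 by rewrite PR.
have [k _ Rk] := qR1.
have Nk : (N <= k)%N.
  rewrite leqNgt; apply/negP => kN; apply: nY; exists q.1; split=> //.
  by right; exists k.
apply: (conn_nbh (A := path_vertices q) (x := q.1)) => [z qz Bz||].
- by apply: nY; exists z; split=> //; left.
- by exists q.2; split=> //; case/andP: (Ppath q Pq).
- by rewrite -Rk; apply: RB.
Qed.

(** Almost all teeth lie in [B], and almost all paths of the star avoid [nbh B] outside [c]. So some
    path of the star ends in [B] without meeting [nbh B] after [c], and its vertex next to [c] is in
    [B]. *)
Lemma dominating_vertex_side (R : nat -> G) P (c : G) L (B : set G) :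
  is_comb R P -> is_star c L -> infinite_set (leaves c L `&` teeth P) ->
  finite_set (nbh B) -> has_tail_in R B -> B c \/ nbh B c.
Proof.
move=> combR [_ Lpath tL] inf fB RB.
have fP := comb_teeth_almost_in combR fB RB.
have fL := trivIset_finite_meet tL fB.
have [p [Lp Bp pB]] : exists p, [/\ L p, B (last c p) &
    ~ ([set` p] `&` nbh B !=set0)].
  apply: contrapT => np; apply: inf.
  have : finite_set (path_end (G := G) @` [set q | P q /\ ~ B (path_end q)] `|`
    last c @` [set p | L p /\ [set` p] `&` nbh B !=set0]).
    by rewrite finite_setU; split; apply: finite_image.
  apply: sub_finite_set.
  move=> x [[p Lp px] [q Pq qx]].
  have [Bq|nBq] := pselect (B (path_end q)); last by left; exists q.
  right; exists p => //; split=> //; apply: contrapT => npB; apply: np.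
  by exists p; split=> //; rewrite px -qx.
case: p Lp Bp pB => [/Lpath[]//|a p Lp /= Bp pB].
have [_ /andP[/andP[ca ap] _]] := Lpath _ Lp.
have Ba : B a.
  apply: (conn_nbh (A := [set` a :: p])) Bp => [z pz Bz|].
    by apply: pB; exists z.
  by apply: conn_sym; exists p; split.
have [|nBc] := pselect (B c); first by left.
by right; split=> //; exists a; rewrite // adj_sym.
Qed.

End Domination.

Lemma path_cross (T : graph) (Q : set T) x p :
  path (adj T) x p -> ~ Q x -> Q (last x p) ->
  exists a b, [/\ a \in x :: p, b \in x :: p, adj T a b, ~ Q a & Q b].
Proof.
elim: p x => [//|y p IH] x /= /andP[xy yp] nQx Ql.
have [Qy|nQy] := pselect (Q y).
  by exists x, y; split; rewrite ?inE ?eqxx ?orbT.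
have [a [b [ap bp ab nQa Qb]]] := IH y yp nQy Ql.
by exists a, b; split; rewrite // inE ?ap ?bp orbT.
Qed.

(** * Sides of the edges of a decomposition tree *)

Section Sides.
Variables (G : graph) (D : rooted_tree_decomposition G).
Implicit Types s t u v : D.

Lemma side_refl s t : side s t t.
Proof. by exists [::]. Qed.

Lemma side_step s t u v : side s t u -> adj D u v ->
  (u, v) <> (s, t) -> (u, v) <> (t, s) -> side s t v.
Proof.
move=> [p [tp <-]] uv /eqP n1 /eqP n2; exists (rcons p v).
by rewrite rcons_path tp last_rcons /= uv !inE negb_or n1 n2.
Qed.

Lemma side_cross s t u v :
  side s t u -> ~ side s t v -> adj D u v -> u = t /\ v = s.
Proof.
move=> su nsv uv; apply: contrapT => nuv; apply: (nsv).
apply: side_step su uv _ _ => -[ut vs].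
  by apply: nsv; rewrite vs; apply: side_refl.
by apply: nuv.
Qed.

Lemma nbh_side s t : nbh (side s t) `<=` [set s].
Proof. by move=> v [nv [u su uv]]; case: (side_cross su nv uv). Qed.

Lemma tree_edge_side s t : adj D s t -> ~ side s t s.
Proof.
move=> st [p [tp lp]]; case: (td_is_tree D) => _ acyc.
case: (shortenP tp) lp => q tq uq _ lq {p tp}.
have tq' : path (adj D) t q by apply: sub_path tq => a b /andP[].
have : is_path t q by rewrite /is_path tq'.
move=> /acyc; rewrite lq st; case: q tq lq {tq' uq} => [|a [|b q]] /=.
- by move=> _ ts; rewrite ts adj_irrefl in st.
- by move=> /andP[/andP[_ nE] _] as_; move: nE; rewrite as_ !inE eqxx orbT.
- by move=> _ _ /(_ isT).
Qed.

Lemma on_path_side s t u v : side s t u -> ~ side s t v ->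
  on_path v u s /\ on_path v u t.
Proof.
have [[_ conT] _] := td_is_tree D.
move=> su nsv; have [p [vp lp _]] := conT v u I I.
have /andP[vp' _] := vp.
have [|a [b [ap bp ab na sb]]] := path_cross (Q := side s t) vp' nsv.
  by rewrite lp.
have [<- <-] : b = t /\ a = s by apply: side_cross sb na _; rewrite adj_sym.
by split; exists p; split.
Qed.

Lemma part_side s t u v x : side s t u -> ~ side s t v ->
  td_part D u x -> td_part D v x -> separator s t x.
Proof.
move=> su nsv ux vx; have [ps pt] := on_path_side su nsv.
by split; [apply: td_convex ps _ _ | apply: td_convex pt _ _].
Qed.

(** Consider a part containing both ends of an edge that leaves the set. If its node is on the side
    of [t], the outer end must be in the separator; otherwise convexity would put the inner end
    there. *)
Lemma nbh_side_part s t :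
  nbh ((\bigcup_(u in side s t) td_part D u) `\` separator s t) `<=` separator s t.
Proof.
move=> v [nv [w [[u su uw] nw] wv]]; apply: contrapT => nsv.
have [r [rw rv]] := @td_cover_edge _ D _ _ wv.
have [sr|nsr] := pselect (side s t r).
  by apply: nv; split=> //; exists r.
by apply: nw; apply: part_side su nsr uw rw.
Qed.

(** The path from [S 0] to [t] is finite, so for large [n] one can walk from [t] to [S n] without
    passing [S n.+1]. If [t] were beyond the edge, [S n] would be too. *)
Lemma ray_side_misses (S : nat -> D) t : is_ray S ->
  exists N, forall n, (N <= n)%N -> ~ side (S n) (S n.+1) t.
Proof.
move=> Sray; have [[_ conT] _] := td_is_tree D.
have [p [Sp lp _]] := conT (S 0%N) t I I.
have [N SN] := ray_avoids_finite Sray (finite_seq (S 0%N :: p)).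
exists N => n Nn side_t; have := tree_edge_side (proj2 Sray n); apply.
have c0 : conn [set z | z != S n.+1] (S 0%N) t.
  exists p; split=> //; first by case/andP: Sp.
  move=> z zp /=; apply/eqP => zS; apply: (SN n.+1); first exact: leqW.
  by rewrite /= -zS.
have nS k : (k <= n)%N -> [set z | z != S n.+1] (S k).
  by move=> kn /=; apply/eqP => /(proj1 Sray) E; move: kn; rewrite E ltnn.
have cn k : (k <= n)%N -> conn [set z | z != S n.+1] (S 0%N) (S k).
  elim: k => [|k IH] kn; first by apply: conn_refl; apply: nS.
  apply: conn_trans (IH (ltnW kn)) (conn_edge (nS _ (ltnW kn)) (nS _ kn) _).
  by case: Sray.
have tn := conn_trans (conn_sym c0) (cn n (leqnn n)).
apply: conn_inv tn side_t => u v /eqP nu /eqP nv uv su.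
by apply: side_step su uv _ _ => -[].
Qed.

(** The dominating vertex [c] lies in parts beyond every edge of [S], yet also in the part of a node
    [t] that late edges leave behind. By convexity it lies in all late separators, although
    consecutive ones are disjoint. *)
Lemma displayed_end_undominated (U : set G) :
  displaying_decomposition U D -> ~ has_dominated_comb U.
Proof.
move=> [finsep disj [tau [tauP [tau_end _ _] _]]].
move=> [R [P [RP [c [L [starL infL]]]]]].
have [combR _] := RP; have [Rray _ _ _ _] := combR.
pose w := [set S | is_ray S /\ ray_equiv R S].
have wR : w R by split=> //; apply: ray_equiv_refl.
have wE : ends G w by apply: end_of_ray.
have [h hE hw] : [set inr h | h in ends D] (tau w).
  by apply: tau_end; split=> //; exists R, P.
have := tauP w wE; rewrite -hw => -[_ orw].
have [S hS] := end_inhabited hE; have Sray := end_ray hE hS.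
have Sadj n : adj D (S n) (S n.+1) by case: Sray.
pose sd n := side (S n) (S n.+1).
pose sep n := separator (S n) (S n.+1).
have fsep n : finite_set (sep n) by apply: finsep.
have Sn_side n k : (n < k)%N -> sd n (S k).
  elim: k => // k IH; rewrite ltnS leq_eqVlt => /predU1P[<-|nk].
    exact: side_refl.
  apply: side_step (IH nk) (Sadj k) _ _ => -[] /(proj1 Sray) E1 /(proj1 Sray); lia.
have c_side n : (\bigcup_(u in sd n) td_part D u) c.
  have orn : orients w (S n) (S n.+1).
    apply: orw => // S' hS'; apply: end_tail hE hS hS' _ _.
      exact: sub_finite_set (@nbh_side _ _) (finite_set1 _).
    by exists n.+1 => k; apply: Sn_side.
  have [|[]//|/nbh_side_part nc] := dominating_vertex_side combR starL infL _ (orn R wR).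
    exact: sub_finite_set (@nbh_side_part _ _) (fsep n).
  by exists (S n.+1); [apply: side_refl | case: nc].
have [t tc] := @td_cover_vertex _ D c.
have [N1 N1P] := ray_side_misses t Sray.
(* Beyond [N2] the ray [S] moves away from the root, as needed for applying upwards disjointness to
   consecutive edges. *)
have [N2 N2P] := ray_side_misses (td_root D) Sray.
pose n := maxn N1 N2.
have csep k : (n <= k)%N -> sep k c.
  rewrite geq_max => /andP[k1 _].
  by have [u su uc] := c_side k; apply: part_side su (N1P k k1) uc tc.
have : (sep n `&` sep n.+1) c by split; apply: csep.
rewrite /sep (disj (S n) (S n.+1) (S n.+1) (S n.+2)) //.
- by apply/eqP => -[/(proj1 Sray)]; lia.
- by apply/eqP => -[/(proj1 Sray)]; lia.
- by apply: (on_path_side (side_refl _ _) (N2P n _)).1; apply: leq_maxr.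
- by apply: (on_path_side (side_refl _ _) (N2P n _)).2; apply: leq_maxr.
Qed.

End Sides.

(** * Splitting off the closure of a set from a finite set *)

Lemma infinite_image (T T' : Type) (f : T -> T') (I : set T) :
  injective f -> infinite_set I -> infinite_set (f @` I).
Proof.
move=> finj infI /(finite_preimage (in2W finj)) fI; apply: infI.
by apply: sub_finite_set fI => i Ii; exists i.
Qed.

Lemma pigeonhole (T : eqType) (X : set T) (x : nat -> T) :
  finite_set X -> (forall n, X (x n)) ->
  exists2 y, X y & infinite_set [set n | x n = y].
Proof.
move=> fX xX; apply: contrapT => ny; apply: infinite_nat.
have fxy y : X y -> finite_set [set n | x n = y].
  by move=> Xy; apply: contrapT => inf; apply: ny; exists y.
by apply: sub_finite_set (bigcup_finite fX fxy) => n _; exists (x n).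
Qed.

Section Separation.
Variables (G : graph) (U X : set G).
Implicit Types (D E F : set G).

(** The two ways for a branch of the process to stop. For a set meeting [U] this says that the set
    and its neighbourhood both avoid [X]. *)
Definition split_off D :=
  (forall x, D x -> ~ X x) /\
  ((forall x, D x -> ~ U x) \/ (forall x, nbh D x -> ~ X x)).

(* A derivation is the deletion process with every branch stopping. *)
Inductive separable : set G -> Prop :=
| separable_split D : split_off D -> separable D
| separable_cut D F : finite_set F ->
    (forall x, (D `\` F) x -> separable (comp (D `\` F) x)) -> separable D.

(** Distinct members are disjoint and have no edges between them, but may share neighbours. The last
    clause makes the family catch every ray that ends up in [D]. *)
Definition separating_family D (FF : set (set G)) :=
  [/\ forall E, FF E ->
        [/\ E `<=` D, connected_in E, finite_set (nbh E) & split_off E],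
      forall E E' x, FF E -> FF E' -> E x -> (E' `|` nbh E') x -> E = E'
    & forall R, is_ray R -> has_tail_in R D -> exists2 E, FF E & has_tail_in R E].

Lemma comp_eq (A : set G) x y z : comp A x z -> comp A y z -> comp A x = comp A y.
Proof.
move=> xz yz; have xy := conn_trans xz (conn_sym yz).
apply/seteqP; split=> t ct; last exact: conn_trans xy ct.
exact: conn_trans (conn_sym xy) ct.
Qed.

(** By induction on the derivation: after a cut, the families of the components are united. A ray
    with a tail in [D] has a tail avoiding the finite set [F], hence in one component. *)
Lemma separable_family D : separable D -> connected_in D -> finite_set (nbh D) ->
  exists FF, separating_family D FF.
Proof.
elim=> {D} [D Dsplit cD fD|D F fF _ IH cD fD].
  exists [set D]; split=> [E ->|E E' x -> ->|R Rray RD]//; [by split | by exists D].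
pose A := D `\` F.
have fA x : finite_set (nbh (comp A x)).
  apply: sub_finite_set (_ : finite_set (nbh D `|` F)); last by rewrite finite_setU.
  move=> v xv; have nAv := nbh_comp xv; have [_ [w xw wv]] := xv.
  have [Fv|nFv] := pselect (F v); [by right | left].
  split=> [Dv|]; first exact: nAv.
  by exists w => //; case: (comp_sub xw).
(* Families are chosen for components rather than for vertices, so that two vertices of one
   component get the same family. *)
have /choice[f fP] (C : set G) : exists FF : set (set G),
    (exists2 x, A x & C = comp A x) -> separating_family C FF.
  have [[x Ax ->]|nC] := pselect (exists2 x, A x & C = comp A x).
    by have [FF FFP] := IH x Ax (comp_connected Ax) (fA x); exists FF.
  by exists set0.
have {}fP x : A x -> separating_family (comp A x) (f (comp A x)).
  by move=> Ax; apply: fP; exists x.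
exists [set E | exists2 x, A x & f (comp A x) E]; split.
- move=> E [x Ax fE]; have [/(_ E fE)[Ex cE fE' sE] _ _] := fP x Ax; split=> //.
  by move=> y /Ex /comp_sub [].
- move=> E E' z [x Ax fE] [y Ay fE'] Ez E'z.
  have [fx fxx _] := fP x Ax; have [Ex _ _ _] := fx E fE.
  have [fy _ _] := fP y Ay; have [Ey _ _ _] := fy E' fE'.
  have xz := Ex z Ez.
  have yz : comp A y z.
    case: E'z => [/Ey//|[_ [w /Ey yw wz]]].
    exact: conn_trans yw (conn_edge (comp_sub yw) (comp_sub xz) wz).
  apply: fxx Ez E'z => //; by rewrite (comp_eq xz yz).
- move=> R Rray RD.
  have [N RN] := has_tailI RD (ray_avoids_finite Rray fF).
  have AN : A (R N) by apply: RN.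
  have [_ _ /(_ R Rray)[]] := fP _ AN.
    by exists N => n Nn; apply: ray_conn RN _ _.
  by move=> E fE RE; exists E => //; exists (R N).
Qed.

Hypothesis finX : finite_set X.
Hypothesis undominated : ~ has_dominated_comb U.

(** Some [c] in [X] has neighbours in infinitely many blocks; in each of these a path continues from
    a neighbour of [c] to the tooth. These paths avoid [c], as the blocks avoid [X]. *)
Lemma dominated_comb_of_blocks (F : nat -> set G) :
  (forall n, connected_in (F n)) ->
  (forall m n x, F m x -> F n x -> m = n) ->
  (forall n, exists x y, [/\ F n x, F n.+1 y & adj G x y]) ->
  (forall n, F n `&` U !=set0) ->
  (forall n x, F n x -> ~ X x) ->
  (forall n, exists x y, [/\ F n x, X y & adj G y x]) ->
  has_dominated_comb U.
Proof.
move=> cF dF aF UF nXF XF.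
have /choice[u uP] := UF.
have [R [P [combR Pu _]]] := comb_of_blocks cF dF aF (fun n => (uP n).1).
have uinj : injective u.
  by move=> m n E; apply: dF (uP m).1 _; rewrite E; case: (uP n).
have /choice[e eP] n : exists e, [/\ F n e.1, X e.2 & adj G e.2 e.1].
  by have [x [y H]] := XF n; exists (x, y).
have Xe n : X (e n).2 by case: (eP n).
have [c Xc infI] := pigeonhole finX Xe.
have /choice[p pP] n : exists p, [/\ is_path (e n).1 p, last (e n).1 p = u n &
    path_vertices ((e n).1, p) `<=` F n].
  apply/connP; case/connected_inP: (cF n) => _; apply; first by case: (eP n).
  by case: (uP n).
pose q n := (e n).1 :: p n.
have qF n x : x \in q n -> F n x by case: (pP n) => _ _ pF /pF.
have qinj : injective q.
  move=> m n E; apply: (dF m n (e m).1); apply: qF; first exact: mem_head.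
  by rewrite -E mem_head.
exists R, P; split; first by split=> //; rewrite Pu => _ [n _ <-]; case: (uP n).
exists c, (q @` [set n | (e n).2 = c]); split; first split.
- exact: infinite_image.
- move=> _ [n nc <-]; split=> //; rewrite /is_path /=.
  have [_ _ ] := eP n; rewrite nc => -> /=.
  case: (pP n) => /andP[-> up] _ _; move: up => /= ->; rewrite andbT.
  by apply/negP => /qF /nXF.
- by move=> _ _ [m _ <-] [n _ <-] [x [/= /qF mx /qF /(dF _ _ _ mx)->]].
- have := infinite_image uinj infI; apply: contra_not; apply: sub_finite_set.
  move=> _ [n nc <-]; rewrite Pu; split; last by exists n.
  by exists (q n); [exists n | case: (pP n)].
Qed.

Lemma connected_separable D :
  connected_in D -> (forall x, D x -> ~ X x) -> separable D.
Proof.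
move=> cD DX; apply: contrapT => nsD; apply: undominated.
(* A state consists of the current set and the block removed last, which sends an edge to the
   current set. *)
pose good (s : set G * set G) := [/\ connected_in s.1, forall x, s.1 x -> ~ X x,
  ~ separable s.1 & s.2 `&` nbh s.1 !=set0].
pose step (s s' : set G * set G) :=
  [/\ connected_in s'.2 /\ s'.2 `<=` s.1, s'.1 `<=` s.1 `\` s'.2,
    exists x y, [/\ s.2 x, s'.2 y & adj G x y], s'.2 `&` U !=set0 &
    exists x y, [/\ s'.2 x, X y & adj G y x]].
have bad C : connected_in C -> (forall x, C x -> ~ X x) -> ~ separable C ->
    C `&` U !=set0 /\ X `&` nbh C !=set0.
  move=> cC CX nC; split; apply: contrapT => nn; apply: nC; apply: separable_split.
    by split=> //; left=> x Cx Ux; apply: nn; exists x.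
  by split=> //; right=> x Cx Xx; apply: nn; exists x.
have /choice[f fP] s : exists s', good s -> good s' /\ step s s'.
  have [gs|] := pselect (good s); last by exists s.
  case: s gs => C F [/= cC CX nC [y [Fy [_ [a Ca ay]]]]].
  have [[u [Cu Uu]] [x [Xx [_ [m Cm mx]]]]] := bad C cC CX nC.
  (* The next block contains a neighbour [a] of the previous block, a vertex [u] of [U] and a vertex
     [m] adjacent to [X]. *)
  have [|F' [fF' cF' sF' F'C]] :=
    @connected_hull _ _ [set` [:: a; u; m]] cC _ (finite_seq _).
    by move=> z /=; rewrite !inE => /or3P[] /eqP->.
  have [F'a F'u F'm] : [/\ F' a, F' u & F' m].
    by split; apply: sF'; rewrite /= !inE eqxx ?orbT.
  have [z [Cz nz]] : exists z, (C `\` F') z /\ ~ separable (comp (C `\` F') z).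
    apply: contrapT => nz; apply: nC; apply: (separable_cut fF') => z Cz.
    by apply: contrapT => ns; apply: nz; exists z.
  have sub : comp (C `\` F') z `<=` C `\` F' by apply: comp_sub.
  exists (comp (C `\` F') z, F') => _; split; last first.
    split=> //=; first by exists y, a; rewrite adj_sym.
      by exists u.
    by exists m, x; rewrite adj_sym.
  split=> //=; first exact: comp_connected.
    by move=> t /sub[/CX].
  have [_ nF'] := Cz; have cCP := proj2 ((connected_inP _).1 cC).
  have [] := @conn_meets_nbh _ _ (comp (C `\` F') z) _ _ (cCP a z Ca (Cz.1)).
  - by move=> /sub[_].
  - exact: conn_refl.
  - move=> t Ct nt; exists t; split=> //; apply: contrapT => nF't.
    by apply: (nbh_comp nt).
(* [X] serves as the block before the first one; as it need not be connected, the blocks are taken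
   from index 1 on. *)
pose s n := iter n f (D, X).
have gs n : good (s n).
  elim: n => [|n IH]; last exact: (fP _ IH).1.
  by split=> //; case: (bad D).
have ss n : step (s n) (s n.+1) by exact: (fP _ (gs n)).2.
have Fsub n : (s n.+1).2 `<=` (s n).1 by case: (ss n) => -[].
have Dsub n : (s n.+1).1 `<=` (s n).1 by case: (ss n) => _ sub _ _ _ x /sub[].
have Dle m n : (m <= n)%N -> (s n).1 `<=` (s m).1.
  elim: n => [|n IH]; first by rewrite leqn0 => /eqP->.
  by rewrite leq_eqVlt => /predU1P[->//|/IH mn] x /Dsub /mn.
have disj m n x : (m < n)%N -> (s m.+1).2 x -> ~ (s n.+1).2 x.
  by move=> mn mx /Fsub /(Dle _ _ mn); case: (ss m) => _ sub _ _ _ /sub[].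
apply: (@dominated_comb_of_blocks (fun n => (s n.+1).2)).
- by move=> n; case: (ss n) => -[].
- move=> m n x mx nx; apply/eqP; rewrite eqn_leq.
  apply/andP; split; rewrite leqNgt; apply/negP => /disj.
    by move/(_ _ nx).
  by move/(_ _ mx).
- by move=> n; case: (ss n.+1).
- by move=> n; case: (ss n).
- by move=> n x /Fsub; case: (gs n) => _ DXn _ _ /DXn.
- by move=> n; case: (ss n).
Qed.

Lemma separating_family_exists D : connected_in D -> finite_set (nbh D) ->
  exists FF, separating_family D FF.
Proof.
move=> cD fD; apply: separable_family => //; apply: (separable_cut finX) => x Dx.
apply: connected_separable; first exact: comp_connected.
by move=> y /comp_sub[].
Qed.

End Separation.

(** * Trees of lists *)

(** At most one edge joins [Q] to its complement. A path that visits both sides but starts and ends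
    on the same one would use it twice, and so repeat a vertex. *)
Lemma uniq_path_side (T : graph) (Q : set T) (a b : T) :
  (forall u v, Q u -> ~ Q v -> adj T u v -> u = a /\ v = b) ->
  forall x p, is_path x p -> (Q x <-> Q (last x p)) ->
  forall z, z \in x :: p -> (Q z <-> Q x).
Proof.
move=> Qab x p; elim: p x => [|y p IH] x.
  by move=> _ _ z; rewrite inE => /eqP->.
rewrite /is_path /= => /andP[/andP[xy yp]].
rewrite inE negb_or => /and3P[/andP[nxy xp] yp' up].
have uyp : is_path y p by rewrite /is_path yp /= yp' up.
have [Qxy|nQxy] := pselect (Q x <-> Q y).
  move=> Ql z; rewrite inE => /predU1P[->//|zp].
  by rewrite Qxy; apply: IH uyp _ z zp; rewrite -Qxy.
suff cross : Q (last y p) <-> Q y by rewrite cross.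
have ab : x = a /\ y = b \/ y = a /\ x = b.
  have [Qx|nQx] := pselect (Q x).
    by left; apply: Qab => // Qy; apply: nQxy.
  right; apply: Qab; rewrite // 1?adj_sym//.
  by apply: contrapT => nQy; apply: nQxy.
(* Having crossed from [x] to [y], the path never returns to [x], an end of the only crossing
   edge. *)
have : conn [set z | z != x] y (last y p).
  exists p; split=> // z zp /=; apply/eqP => zx; move: zp.
  by rewrite /= zx inE (negPf nxy) (negPf xp).
move=> c; have inv (Q' : set T) : (forall u v, Q' u -> ~ Q' v -> adj T u v ->
    u = x \/ v = x) -> Q' y -> Q' (last y p).
  move=> Q'x; apply: conn_inv (c) => u v /= /eqP ux /eqP vx uv Qu.
  by apply: contrapT => nQv; case: (Q'x u v Qu nQv uv).
have Qx u v : Q u -> ~ Q v -> adj T u v -> u = x \/ v = x.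
  move=> Qu nQv uv; have [-> ->] := Qab u v Qu nQv uv.
  by case: ab => -[E1 E2]; [left | right].
split; last exact: inv.
have := inv (~` Q); rewrite /setC /= => invC.
move=> Ql; apply: contrapT => nQy; apply: invC Ql => // u v nQu /contrapT Qv uv.
by have [] := Qx v u Qv nQu _; [rewrite adj_sym | right | left].
Qed.

Lemma side_eq (G : graph) (D : rooted_tree_decomposition G) (s t : D) (Q : set D) :
  (forall u v, Q u -> ~ Q v -> adj D u v -> u = t /\ v = s) ->
  Q t -> ~ Q s -> (forall u, Q u -> conn Q t u) -> side s t = Q.
Proof.
move=> Qts Qt nQs Qc; apply/seteqP; split=> u; last first.
  move=> /Qc c; apply: conn_inv c (side_refl s t) => x y Qx Qy xy sx.
  by apply: side_step sx xy _ _ => -[E1 E2]; apply: nQs; rewrite -?E1 -?E2.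
have H p x : Q x ->
    path [rel x y | adj D x y && ((x, y) \notin [:: (s, t); (t, s)])] x p ->
    Q (last x p).
  elim: p x => //= v p IH w Qw /andP[/andP[wv nwv] vp].
  apply: IH vp; apply: contrapT => nQv; have [wt vs] := Qts w v Qw nQv wv.
  by move: nwv; rewrite wt vs !inE eqxx orbT.
by move=> [p [tp <-]]; apply: H.
Qed.

Section ListTree.
Variables (T : eqType) (valid : pred (seq T)).

Definition node := {s : seq T | valid s}.
Implicit Types s t u z : node.

Definition child s t := (val t != [::]) && (behead (val t) == val s).
Definition node_adj s t := child s t || child t s.

Lemma childP s t : reflect (exists x, val t = x :: val s) (child s t).
Proof.
rewrite /child; apply: (iffP andP) => [[]|[x ->]]; last by rewrite /= eqxx.
by case: (val t) => // x q _ /= /eqP->; exists x.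
Qed.

Lemma node_adj_sym : symmetric node_adj.
Proof. by move=> s t; rewrite /node_adj orbC. Qed.

Lemma node_adj_irrefl : irreflexive node_adj.
Proof.
move=> s; rewrite /node_adj orbb; apply/negP => /childP[x] /(congr1 size)/eqP.
by rewrite ltn_eqF /=.
Qed.

Definition list_tree := Graph node_adj_sym node_adj_irrefl.

(** The parent of a list is its tail, so ancestors are suffixes: this is the subtree of the nodes
    whose path to the root contains [z]. *)
Definition desc z : set list_tree := [set s | suffix (val z) (val s)].

Lemma desc_refl z : desc z z.
Proof. exact: suffix_refl. Qed.

Lemma desc_trans s t u : desc s t -> desc t u -> desc s u.
Proof. exact: suffix_trans. Qed.

Lemma child_desc s t : child s t -> desc s t.
Proof. by move/childP => [x E]; rewrite /desc /= E suffix_cons. Qed.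

Lemma desc_child s t z : child s t -> desc z t -> z = t \/ desc z s.
Proof.
move=> /childP[x E]; rewrite /desc /= => /suffixP[[|y q] /= E'].
  by left; apply: val_inj.
have [_ ->] : x :: val s = y :: (q ++ val z) by rewrite -E -E'.
by right; exact: suffix_suffix.
Qed.

Lemma desc_anti s t : desc s t -> desc t s -> s = t.
Proof.
rewrite /desc /= => /suffixP[q E]; rewrite E => /size_suffix; rewrite size_cat => sq.
by apply: val_inj; case: q E sq => [E _|y q _] /=; [exact: esym E | lia].
Qed.

Lemma desc_comparable s t u : desc s u -> desc t u -> desc s t \/ desc t s.
Proof.
wlog st : s t / (size (val s) <= size (val t))%N.
  move=> W; have [st|/ltnW ts] := leqP (size (val s)) (size (val t)); first exact: W.
  by move=> su tu; apply/or_comm/W.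
case: s t u st => [s vs] [t vt] [u vu]; rewrite /desc /= => st su tu; left.
have := size_suffix tu; move: su tu; rewrite !suffixE => /eqP su /eqP tu tus.
by rewrite -[X in drop _ X]tu drop_drop; apply/eqP; rewrite -[RHS]su; congr drop; lia.
Qed.

Lemma desc_cross z u v : desc z u -> ~ desc z v -> node_adj u v ->
  u = z /\ child v z.
Proof.
move=> zu nzv /orP[uv|vu].
  by case: nzv; apply: desc_trans zu (child_desc uv).
have [E|//] := desc_child vu zu.
by rewrite E.
Qed.

Lemma child_inj s t z : child s z -> child t z -> s = t.
Proof. by move=> /andP[_ /eqP E] /andP[_ /eqP E']; apply: val_inj; rewrite /= -E. Qed.

Lemma nbh_desc_finite z : finite_set (nbh (desc z)).
Proof.
have [[s sz]|ns] := pselect (exists s, child s z).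
  apply: sub_finite_set (finite_set1 s) => v [nzv [u zu uv]].
  by have [_ vz] := desc_cross zu nzv uv; apply: child_inj vz sz.
apply: sub_finite_set (finite_set0 _) => v [nzv [u zu uv]].
by have [_ vz] := desc_cross zu nzv uv; apply: ns; exists v.
Qed.

Lemma size_desc_eq s t : desc s t -> (size (val t) <= size (val s))%N -> s = t.
Proof.
rewrite /desc /= => /suffixP[q E]; rewrite E size_cat => sq.
by apply: val_inj; case: q E sq => [E _|y q _] /=; [exact: esym E | lia].
Qed.

Hypothesis valid_nil : valid [::].
Hypothesis valid_cons : forall x (s : seq T), valid (x :: s) -> valid s.

Definition root : list_tree := exist _ [::] valid_nil.

Lemma desc_root s : desc root s.
Proof. exact: suffix0s. Qed.

Lemma parent_exists t : t <> root -> exists s, child s t.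
Proof.
case: t => -[|x s] vt nt; first by case: nt; apply: val_inj.
by exists (exist _ s (valid_cons vt)); apply/childP; exists x.
Qed.

Lemma desc_ind z (P : node -> Prop) : P z ->
  (forall s t, desc z s -> child s t -> P s -> P t) -> forall t, desc z t -> P t.
Proof.
move=> Pz PS t; move En: (size (val t)) => n.
elim: n t En => [|n IH] t En zt.
  suff -> : t = z by [].
  apply: val_inj; move: zt; rewrite /desc /= (size0nil En).
  by rewrite suffixs0 => /eqP->.
have [|s st] := @parent_exists t; first by move=> E; rewrite E in En.
have [<-//|zs] := desc_child st zt.
by apply: PS (zs) (st) _; apply: IH zs; case/childP: st En => x -> [].
Qed.

Lemma desc_strict z t : desc z t -> z = t \/ exists s, child z s /\ desc s t.
Proof.
move: t; apply: desc_ind => [|s t zs st [->|[z' [zz' z's]]]]; first by left.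
  by right; exists t; split=> //; apply: desc_refl.
by right; exists z'; split=> //; apply: desc_trans z's (child_desc st).
Qed.

Lemma conn_desc z s : desc z s -> conn (desc z) z s.
Proof.
move: s; apply: desc_ind => [|s t zs st c]; first exact/conn_refl/desc_refl.
apply: conn_trans c (conn_edge zs (desc_trans zs (child_desc st)) _).
by apply/orP; left.
Qed.

Lemma path_desc z : forall x p, is_path (G := list_tree) x p ->
  (desc z x <-> desc z (last x p)) -> forall t, t \in x :: p -> (desc z t <-> desc z x).
Proof.
have [zr x p _ _ t _|nzr] := pselect (z = root).
  by rewrite zr; split=> _; apply: desc_root.
have [s sz] := parent_exists nzr.
apply: (@uniq_path_side list_tree _ z s) => u v zu nzv uv.
by have [-> vz] := desc_cross zu nzv uv; split=> //; apply: child_inj vz sz.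
Qed.

Lemma list_tree_connected : connected_graph list_tree.
Proof.
apply/connected_inP; split; first by exists root.
have c s : conn [set: list_tree] root s.
  by apply: conn_sub (conn_desc (desc_root s)).
by move=> s t _ _; apply: conn_trans (conn_sym (c s)) (c t).
Qed.

(** The first edge of a cycle is the only edge leaving the subtree at its end further from the root.
    The rest of the cycle joins the ends of that edge and would have to leave the subtree as
    well. *)
Lemma list_tree_acyclic : acyclic list_tree.
Proof.
move=> x [//|y [//|w p]] xp _; apply/negP => lx.
have /andP[/= /andP[xy _] /andP[nx /andP[ny _]]] := xp.
set l := last x _ in lx; have lE : l = last w p by [].
have ly : l <> y by move=> E; move: ny; rewrite -E lE mem_last.
case/orP: xy => [cxy|cyx].
  have nyx : ~ desc y x.
    move=> dyx; have E := desc_anti (child_desc cxy) dyx.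
    by move: nx; rewrite E mem_head.
  have [yl|nyl] := pselect (desc y l).
    by have [] := desc_cross yl nyx lx.
  have H : desc y x <-> desc y l by split=> [/nyx|/nyl].
  apply: nyx; apply/(path_desc xp H (t := y)); last exact: desc_refl.
  by rewrite !inE eqxx orbT.
have nxy : ~ desc x y.
  move=> dxy; have E := desc_anti (child_desc cyx) dxy.
  by move: nx; rewrite -E mem_head.
have [xl|nxl] := pselect (desc x l).
  have H : desc x x <-> desc x l by split=> // _; apply: desc_refl.
  apply: nxy; apply/(path_desc xp H (t := y)); last exact: desc_refl.
  by rewrite !inE eqxx orbT.
have xl' : node_adj x l by rewrite node_adj_sym.
have [_ clx] := desc_cross (desc_refl x) nxl xl'.
by apply: ly; apply: child_inj clx cyx.
Qed.

Lemma list_tree_is_tree : is_tree list_tree.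
Proof. by split; [apply: list_tree_connected | apply: list_tree_acyclic]. Qed.

Lemma on_path_root s t : on_path root t s <-> desc s t.
Proof.
split=> [[p [rp <- sp]]|st].
  apply: contrapT => nst; have [E|nE] := pselect (s = root).
    by apply: nst; rewrite E; apply: desc_root.
  have nsr : ~ desc s root.
    by move=> sr; apply: nE; apply: desc_anti sr (desc_root s).
  apply: nsr; apply/(path_desc rp _ sp); last exact: desc_refl.
  by split=> // sr; case: nE; apply: desc_anti sr (desc_root s).
have [[_ conT] _] := list_tree_is_tree.
have [p [rp lp _]] := conT root t I I; exists p; split=> //.
have [->|nE] := pselect (s = root); first exact: mem_head.
have nsr : ~ desc s root.
  by move=> sr; apply: nE; apply: desc_anti sr (desc_root s).
have /andP[rp' _] := rp.
have [|a [b [_ bp ab na sb]]] := path_cross rp' nsr; first by rewrite lp.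
have ba : node_adj b a by rewrite node_adj_sym.
by have [<-] := desc_cross sb na ba.
Qed.

Definition is_branch (b : nat -> list_tree) :=
  b 0%N = root /\ forall n, child (b n) (b n.+1).

Lemma branch_size b n : is_branch b -> size (val (b n)) = n.
Proof.
move=> [b0 bS]; elim: n => [|n IH]; first by rewrite b0.
by have /childP[x ->] := bS n; rewrite /= IH.
Qed.

Lemma branch_desc b m n : is_branch b -> (m <= n)%N -> desc (b m) (b n).
Proof.
move=> [b0 bS]; elim: n => [|n IH]; first by rewrite leqn0 => /eqP->; apply: desc_refl.
rewrite leq_eqVlt => /predU1P[->|/IH mn]; first exact: desc_refl.
exact: desc_trans mn (child_desc (bS n)).
Qed.

Lemma branch_ray b : is_branch b -> is_ray b.
Proof.
move=> bb; split=> [m n E|n]; first by rewrite -(branch_size m bb) E branch_size.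
by case: bb => _ bS; rewrite /= /node_adj bS.
Qed.

(** Parents being unique, a ray that once moves away from the root continues to do so, and it cannot
    approach the root forever. Replacing its start by the path from the root gives the branch. *)
Lemma ray_branch (S : nat -> list_tree) : is_ray S ->
  exists b, is_branch b /\ ray_equiv b S.
Proof.
move=> Sray; have [Sinj Sadj] := Sray.
have up n : child (S n) (S n.+1) -> child (S n.+1) (S n.+2).
  move=> c; case/orP: (Sadj n.+1) => // c'.
  by have /Sinj := child_inj c c'; lia.
have [N SN] : exists N, child (S N) (S N.+1).
  apply: contrapT => nN; have down n : child (S n.+1) (S n).
    by case/orP: (Sadj n) => // c; case: nN; exists n.
  have sz n : (size (val (S n)) + n = size (val (S 0%N)))%N.
    elim: n => [|n <-]; first by rewrite addn0.
    by have /childP[x ->] := down n; rewrite /= addnS addSn.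
  by have := sz (size (val (S 0%N))).+1; lia.
have SNk k : child (S (N + k)%N) (S (N + k).+1).
  by elim: k => [|k IH]; rewrite ?addn0 // addnS; apply: up.
pose d := size (val (S N)).
have sz k : size (val (S (N + k)%N)) = (d + k)%N.
  elim: k => [|k IH]; first by rewrite !addn0.
  by have /childP[x] := SNk k; rewrite addnS => -> /=; rewrite IH addnS.
have vs n k : valid (drop k (val (S n))).
  elim: k => [|k]; first by rewrite drop0; exact: (valP (S n)).
  rewrite -addn1 addnC -drop_drop; case: (drop k _) => [//|x q].
  rewrite drop1; exact: valid_cons.
(* The list [S (N + n)] has length [d + n]; dropping its first [d] entries gives its ancestor at
   level [n]. *)
pose b n : list_tree := exist _ (drop d (val (S (N + n)%N))) (vs _ d).
have bsz n : size (val (b n)) = n by rewrite /= size_drop sz addKn.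
have bS n : child (b n) (b n.+1).
  have /childP[x E] := SNk n; rewrite -addnS in E.
  apply/andP; split; first by rewrite -size_eq0 bsz.
  rewrite -drop1 drop_drop add1n; apply/eqP.
  exact: (congr1 (drop d.+1) E).
have bb : is_branch b by split=> //; apply: val_inj; apply: size0nil; exact: bsz.
have SD m k : desc (S (N + k)%N) (S (N + (m + k))%N).
  elim: m => [|m IH]; first exact: desc_refl.
  by rewrite addSn addnS; apply: desc_trans IH (child_desc (SNk _)).
have bE k : b (d + k)%N = S (N + k)%N.
  have h1 : desc (b (d + k)%N) (S (N + (d + k))%N) by apply: suffix_drop.
  have h2 : desc (S (N + k)%N) (S (N + (d + k))%N) by apply: SD.
  have [/size_desc_eq|/size_desc_eq h] := desc_comparable h1 h2.
    by apply; rewrite sz bsz.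
  by symmetry; apply: h; rewrite sz bsz.
exists b; split=> //; apply/ray_equivP => X fX.
have [M SM] := ray_avoids_finite Sray fX.
exists (d + M)%N, (N + M)%N; rewrite bE; apply/conn_refl/SM; exact: leq_addl.
Qed.
End ListTree.

(** * The decomposition *)

Section Closure.
Variable G : graph.

Definition clos (C : set G) := C `|` nbh C.

Lemma clos_connected C : connected_in C -> connected_in (clos C).
Proof.
move=> /connected_inP[[a Ca] cC].
have c x : clos C x -> conn (clos C) a x.
  have sub : C `<=` clos C by move=> ?; left.
  move=> [Cx|[nCx [w Cw wx]]]; first exact: conn_sub (cC a x Ca Cx).
  apply: conn_trans (conn_sub sub (cC a w Ca Cw)) (conn_edge (sub w Cw) _ wx).
  by right; split=> //; exists w.
apply/connected_inP; split; first by exists a; left.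
by move=> x y /c/conn_sym xa /c; apply: conn_trans.
Qed.

End Closure.

(** * The tree of nested components *)

Section Construction.
Variables (G : graph) (U : set G) (Gconn : connected_graph G).
(** [sepset C] becomes the separator at the entrance of [C], and is also the finite set from which
    [fam C] splits off the next components. *)
Variables (sepset : set G -> set G) (fam : set G -> set (set G)).
Hypothesis sepP : forall C, connected_in C -> finite_set (nbh C) ->
  [/\ finite_set (sepset C), connected_in (sepset C), nbh C `<=` sepset C,
      sepset C `<=` clos C & separating_family U (sepset C) C (fam C)].

(** Members avoiding [U] do not become children; their vertices stay in the part of the current
    node. *)
Definition kid (C E : set G) := fam C E /\ E `&` U !=set0.

(* A node lists the nested components chosen so far, the innermost one first;
   the empty list stands for the whole vertex set. *)
Fixpoint valid (s : seq (set G)) : bool :=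
  if s is E :: s' then `[< kid (head setT s') E >] && valid s' else true.

Lemma valid_cons E s : valid (E :: s) -> valid s.
Proof. by move=> /andP[]. Qed.

Notation T := (list_tree valid).
Notation rt := (root (valid := valid) isT).
Implicit Types s t : T.

Definition dom s : set G := head setT (val s).
(** The separator of the edge from the parent to [s]. At the root, where there is no such edge, it
    is a nonempty finite set that starts the construction. *)
Definition sep s := sepset (dom s).

Lemma child_kid s t : child s t -> kid (dom s) (dom t).
Proof.
move=> /childP[E tE]; rewrite /dom tE /=.
by have := valP t; rewrite tE => /andP[/asboolP].
Qed.

Lemma kid_child s E : kid (dom s) E -> exists t, child s t /\ dom t = E.
Proof.
move=> sE; have v : valid (E :: val s).
  by apply/andP; split; [apply/asboolP | apply: valP].
by exists (exist _ (E :: val s) v); split=> //; apply/childP; exists E.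
Qed.

Lemma tree_ind (P : T -> Prop) : P rt ->
  (forall s t, child s t -> P s -> P t) -> forall t, P t.
Proof.
move=> P0 PS t; apply: (desc_ind isT valid_cons P0) (desc_root _ t) => s u _; exact: PS.
Qed.

Lemma dom_ok s : connected_in (dom s) /\ finite_set (nbh (dom s)).
Proof.
elim/tree_ind: s => [|s t /child_kid[famE _] [cs fs]].
  split; first exact: Gconn.
  by apply: sub_finite_set (finite_set0 _) => v [[]].
by have [_ _ _ _ [/(_ _ famE)[_ ? ? _] _ _]] := sepP cs fs.
Qed.

Lemma dom_connected s : connected_in (dom s). Proof. by case: (dom_ok s). Qed.
Lemma nbh_dom_finite s : finite_set (nbh (dom s)). Proof. by case: (dom_ok s). Qed.
Lemma sep_finite s : finite_set (sep s).
Proof. by case: (dom_ok s) => c f; case: (sepP c f). Qed.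
Lemma sep_connected s : connected_in (sep s).
Proof. by case: (dom_ok s) => c f; case: (sepP c f). Qed.
Lemma nbh_sep s : nbh (dom s) `<=` sep s.
Proof. by case: (dom_ok s) => c f; case: (sepP c f). Qed.
Lemma sep_clos s : sep s `<=` clos (dom s).
Proof. by case: (dom_ok s) => c f; case: (sepP c f). Qed.
Lemma dom_family s : separating_family U (sep s) (dom s) (fam (dom s)).
Proof. by case: (dom_ok s) => c f; case: (sepP c f). Qed.

Lemma child_meets_U s t : child s t -> dom t `&` U !=set0.
Proof. by case/child_kid. Qed.

(** Since [dom t] meets [U], being split off means that its closure avoids [sep s]. This is the
    source of upwards disjointness. *)
Lemma child_clos_sep s t x : child s t -> clos (dom t) x -> ~ sep s x.
Proof.
move=> /child_kid[famt [u [tu Uu]]].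
have [/(_ _ famt)[_ _ _ [tX [tU|nX]]] _ _] := dom_family s; first by case: (tU u).
by case=> [/tX|/nX].
Qed.

Lemma child_clos s t : child s t -> clos (dom t) `<=` dom s.
Proof.
move=> st x tx; have nsx := child_clos_sep st tx.
have [/(_ _ (child_kid st).1)[sub _ _ _] _ _] := dom_family s.
case: tx => [/sub//|[_ [w /sub sw wx]]].
by apply: contrapT => nx; apply/nsx/nbh_sep; split=> //; exists w.
Qed.

Lemma child_dom s t : child s t -> dom t `<=` dom s.
Proof. by move=> st x tx; apply: (child_clos st); left. Qed.

Lemma child_disjoint s t t' x : child s t -> child s t' ->
  dom t x -> clos (dom t') x -> t = t'.
Proof.
move=> st st' tx t'x; have [_ fam1 _] := dom_family s.
have E := fam1 _ _ x (child_kid st).1 (child_kid st').1 tx t'x.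
have [[X Xt] [X' X't]] := (childP _ _ st, childP _ _ st').
apply: val_inj; move: E; rewrite /dom /=.
by rewrite [val t]Xt [val t']X't /= => ->.
Qed.

Lemma desc_dom s t : desc s t -> dom t `<=` dom s.
Proof.
move: t; apply: (desc_ind isT valid_cons) => // t u _ tu ts.
by move=> x /(child_dom tu)/ts.
Qed.

Lemma desc_clos s t : desc s t -> clos (dom t) `<=` clos (dom s).
Proof.
move: t; apply: (desc_ind isT valid_cons) => // t u _ tu ts.
by move=> x /(child_clos tu) ?; apply: ts; left.
Qed.

Lemma desc_clos_sep s t (u : T) x : child s t -> desc t u -> clos (dom u) x -> ~ sep s x.
Proof. by move=> st tu /(desc_clos tu); apply: child_clos_sep. Qed.

Lemma child_size s t : child s t -> size (val t) = (size (val s)).+1.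
Proof. by case/childP => x ->. Qed.

(** Siblings have disjoint domains, so by induction nodes of equal level whose domains meet are
    equal; a deeper [t] is first replaced by its parent. *)
Lemma dom_desc s t x : dom s x -> dom t x -> (size (val s) <= size (val t))%N -> desc s t.
Proof.
elim/tree_ind: t s => [|t' t t't IH] s sx tx.
  rewrite leqn0 size_eq0 => /eqP s0; suff -> : s = rt by apply: desc_refl.
  exact: val_inj.
have t'x := child_dom t't tx.
rewrite (child_size t't) leq_eqVlt => /predU1P[sz|lt]; last first.
  by apply: desc_trans (child_desc t't); apply: IH.
have [|s' s's] := @parent_exists _ _ isT valid_cons s; first by move=> E; rewrite E in sz.
have E : s' = t'.
  have sz' : size (val s') = size (val t') by move: sz; rewrite (child_size s's) => -[].
  by apply: size_desc_eq; rewrite ?sz'//; apply: IH; rewrite ?sz'//; apply: child_dom sx.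
suff -> : s = t by apply: desc_refl.
by apply: (child_disjoint (s := t') (x := x)); rewrite -?E//; [rewrite E | left].
Qed.

Lemma dom_comparable s t x : dom s x -> dom t x -> desc s t \/ desc t s.
Proof.
move=> sx tx; have [st|/ltnW ts] := leqP (size (val s)) (size (val t)).
  by left; apply: dom_desc sx tx st.
by right; apply: dom_desc tx sx ts.
Qed.

Lemma dom_size_inj s t x : dom s x -> dom t x -> size (val s) = size (val t) -> s = t.
Proof.
move=> sx tx E; have st : desc s t by apply: dom_desc sx tx _; rewrite E.
by apply: size_desc_eq st _; rewrite E.
Qed.

(** Moving along an edge of [G] raises the depth by at most one, because the closure of a child's
    domain lies in the parent's domain. A vertex of [sep] at the root is in no other domain, and [G]
    is connected. *)
Lemma dom_bounded v : exists n, forall s, dom s v -> (size (val s) <= n)%N.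
Proof.
have /connected_inP[[r sr] _] := sep_connected rt.
have /connected_inP[_ /(_ r v I I) c] := Gconn.
pose Q v := exists n, forall s, dom s v -> (size (val s) <= n)%N.
suff Qr : Q r.
  apply: (conn_inv (Q := Q) _ c Qr) => u w _ _ uw [n un].
  exists n.+1 => t tw; have [E|] := pselect (t = rt); first by rewrite E.
  move/(parent_exists valid_cons) => [s st]; rewrite (child_size st) ltnS.
  apply: un; apply: (child_clos st); have [tu|ntu] := pselect (dom t u); first by left.
  by right; split=> //; exists w; rewrite // adj_sym.
exists 0%N => t tr; have [->//|] := pselect (t = rt).
move=> nt; exfalso; elim/tree_ind: t tr nt => // s t st IH tr _.
have [E|] := pselect (s = rt).
  by apply: (child_clos_sep st (x := r)); [left | rewrite E].
by apply: IH; apply: child_dom st _ tr.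
Qed.

Lemma dom_bounded_set (Q : set G) : finite_set Q ->
  exists n, forall s, dom s `&` Q !=set0 -> (size (val s) <= n)%N.
Proof.
move=> /finite_seqP[q ->]; elim: q => [|a q [n IH]].
  by exists 0%N => t [x []].
have [m mP] := dom_bounded a; exists (maxn m n) => t [x [tx]].
rewrite /= inE leq_max => /predU1P[xa|xq]; first by rewrite mP// -xa.
by rewrite [X in _ || X]IH ?orbT//; exists x.
Qed.

Lemma deepest (Q : set G) s : finite_set Q -> dom s `&` Q !=set0 ->
  exists t, [/\ desc s t, dom t `&` Q !=set0 &
    forall t', child t t' -> forall x, Q x -> ~ dom t' x].
Proof.
move=> /dom_bounded_set[n nP] sQ.
move Ek : (n - size (val s))%N => k; elim: k s Ek sQ => [|k IH] s Ek sQ.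
  exists s; split=> //; first exact: desc_refl.
  move=> t st x Qx tx; have : (size (val t) <= n)%N by apply: nP; exists x.
  by rewrite (child_size st); lia.
have [[t [st tQ]]|nt] := pselect (exists t, child s t /\ dom t `&` Q !=set0); last first.
  exists s; split=> //; first exact: desc_refl.
  by move=> t st x Qx tx; apply: nt; exists t; split=> //; exists x.
have [|u [tu uQ uP]] := IH t _ tQ; first by rewrite (child_size st); lia.
by exists u; split=> //; apply: desc_trans (child_desc st) tu.
Qed.

(** Of each child's domain the part retains only what belongs to the child's separator. *)
Definition part s : set G :=
  [set v | clos (dom s) v /\ forall t, child s t -> dom t v -> sep t v].

Lemma part_deep s v : clos (dom s) v -> (forall t, child s t -> ~ dom t v) -> part s v.
Proof. by move=> sv ns; split=> // t st /(ns t st). Qed.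

Lemma part_below s v : dom s v -> exists2 t, desc s t & part t v.
Proof.
move=> sv; have [|t [st [x [tx xv]] tP]] := @deepest [set v] s (finite_set1 v).
  by exists v.
exists t => //; rewrite xv in tx; apply: part_deep; first by left.
by move=> t' tt'; apply: tP.
Qed.

(** Take a domain that meets the edge while no child's domain does; its closure contains both [u]
    and [v]. *)
Lemma part_edge u v : adj G u v -> exists t, part t u /\ part t v.
Proof.
move=> uv; have [||t [_ [x [tx uvx]] tP]] := @deepest [set u; v] rt.
- by rewrite finite_setU; split.
- by exists u; split=> //; left.
exists t; suff cl y : [set u; v] y -> clos (dom t) y.
  have pt y : [set u; v] y -> part t y.
    by move=> uvy; apply: part_deep (cl y uvy) _ => t' tt'; apply: tP.
  by split; apply: pt; [left | right].
move=> uvy; have [ty|nty] := pselect (dom t y); first by left.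
right; split=> //; exists x => //.
case: uvx => /= xE; case: uvy => /= yE; rewrite {x}xE {y}yE in tx nty *.
all: by rewrite // adj_sym.
Qed.

Lemma part_sep s t v : child s t -> part s v -> clos (dom t) v -> sep t v.
Proof. by move=> st [_ sP] [/(sP t st)|/nbh_sep]. Qed.

Lemma sep_part s : sep s `<=` part s.
Proof.
move=> v sv; apply: part_deep; first exact: sep_clos.
by move=> t st tv; apply: (child_clos_sep st _ sv); left.
Qed.

Lemma sep_part_parent s t : child s t -> sep t `<=` part s.
Proof.
move=> st v tv; have ct := sep_clos tv; split; first by left; apply: child_clos st _ ct.
by move=> t' st' t'v; rewrite (child_disjoint st' st t'v ct).
Qed.

Lemma part_child s t : child s t -> part s `&` part t = sep t.
Proof.
move=> st; apply/seteqP; split=> v; first by move=> [sv [tv _]]; apply: part_sep st sv tv.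
by move=> tv; split; [apply: sep_part_parent st _ tv | apply: sep_part].
Qed.

(* Every other node whose part contains v lies above the node of part_top v. *)
Definition part_top (v : G) s :=
  part s v /\ forall s', child s' s -> dom s v /\ ~ sep s v.

Lemma part_top_exists s v : part s v ->
  exists s0, [/\ desc s0 s, part_top v s0 & forall t, desc s0 t -> desc t s -> part t v].
Proof.
elim/tree_ind: s => [|s t st IH] pv.
  exists rt; split; [exact: desc_refl | split=> // s' /child_size // |].
  by move=> t rt_t tr; rewrite -(desc_anti rt_t tr).
have [psv|npsv] := pselect (part s v).
  have [s0 [s0s s0v s0P]] := IH psv; exists s0; split=> //.
    exact: desc_trans s0s (child_desc st).
  move=> u s0u ut; have [->//|us] := desc_child st ut; exact: s0P.
exists t; split; first exact: desc_refl; last first.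
  by move=> u tu ut; rewrite -(desc_anti tu ut).
split=> // s' s't; have E := child_inj s't st; rewrite {s'}E in s't *.
have nsep : ~ sep t v by move/(sep_part_parent st).
by split=> //; case: (pv.1) => // /nbh_sep.
Qed.

(** Were [s] a proper ancestor, [v] would lie in the separator of the next node towards [t]. That
    node is not [t], by [part_top], and closures of domains beyond it avoid its separator. *)
Lemma part_top_minimal s t v : part s v -> part_top v t -> desc s t -> s = t.
Proof.
move=> psv [ptv tP] st.
have [//|[t' [st' t't]]] := desc_strict isT valid_cons st.
have t'v : sep t' v by apply: part_sep st' psv (desc_clos t't ptv.1).
have [E|[t'' [t't'' t''t]]] := desc_strict isT valid_cons t't.
  by rewrite E in st' t'v; have [] := tP s st'.
by case: (desc_clos_sep t't'' t''t ptv.1).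
Qed.

Lemma part_top_unique s t v : part_top v s -> part_top v t -> s = t.
Proof.
move=> sv tv; suff [st|ts] : desc s t \/ desc t s.
- exact: part_top_minimal sv.1 tv st.
- by symmetry; apply: part_top_minimal tv.1 sv ts.
have [->|/(parent_exists valid_cons)[s' s's]] := pselect (s = rt).
  by left; apply: desc_root.
have [->|/(parent_exists valid_cons)[t' t't]] := pselect (t = rt).
  by right; apply: desc_root.
exact: dom_comparable (sv.2 _ s's).1 (tv.2 _ t't).1.
Qed.

(** Both ends of the path, hence all its nodes, descend from the unique top node of [v]. Moreover
    [t2] is an ancestor of one end or equal to it, since a path cannot enter and leave the subtree
    of [t2]; and [v] is in all parts from the top node to either end. *)
Lemma part_convex t1 t2 t3 : on_path t1 t3 t2 -> part t1 `&` part t3 `<=` part t2.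
Proof.
move=> [p [t1p lp t2p]] v [v1 v3].
have [s [s1 sv sP1]] := part_top_exists v1.
have [s' [s3 s'v sP3]] := part_top_exists v3.
have {s'v} E := part_top_unique s'v sv; rewrite {s'}E in s3 sP3.
have s2 : desc s t2.
  apply/(path_desc isT valid_cons t1p _ t2p); last by [].
  by rewrite lp.
have [t21|n21] := pselect (desc t2 t1); first exact: sP1.
have [t23|n23] := pselect (desc t2 t3); first exact: sP3.
case: (n21); apply/(path_desc isT valid_cons t1p _ t2p); last exact: desc_refl.
by rewrite lp; split=> [/n21|/n23].
Qed.

Definition decomposition : rooted_tree_decomposition G :=
  @RootedTreeDecomposition G T rt part (list_tree_is_tree isT valid_cons)
    (fun v => let: ex_intro2 t _ tv := part_below (I : dom rt v) in ex_intro _ t tv)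
    part_edge part_convex.

Notation D := decomposition.

Lemma separator_child (s t : D) : child s t -> separator s t = sep t.
Proof. exact: part_child. Qed.

Lemma separatorC (s t : D) : separator s t = separator t s.
Proof. exact: setIC. Qed.

Lemma separator_adj (s t : D) : adj D s t ->
  exists a b : T, [/\ child a b, separator s t = sep b & (s, t) = (a, b) \/ (s, t) = (b, a)].
Proof.
move=> /orP[st|ts].
  by exists s, t; split=> //; [apply: separator_child | left].
exists t, s; split=> //; last by right.
by rewrite separatorC; apply: separator_child.
Qed.

Lemma decomposition_finite : finite_separators D.
Proof. by move=> s t /separator_adj[a [b [_ -> _]]]; apply: sep_finite. Qed.

Lemma decomposition_connected : connected_separators D.
Proof. by move=> s t /separator_adj[a [b [_ -> _]]]; apply: sep_connected. Qed.

(** If [t] is the outer end of the edge nearer the root, the other separator lies in the closure of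
    the domain of a proper descendant of [t], which avoids [sep t]. *)
Lemma decomposition_disjoint : upwards_disjoint_separators D.
Proof.
move=> a b c d ab cd /eqP n1 /eqP n2 /(on_path_root isT valid_cons) ac.
move=> /(on_path_root isT valid_cons) bc.
have key (s t : T) : child s t -> desc t c -> (s, t) <> (d, c) ->
    sep t `&` separator (c : D) d = set0.
  move=> st tc ndc; apply/seteqP; split=> // x [tx].
  case/orP: cd => [cd|dc].
    rewrite separator_child // => /sep_clos dx.
    have [E|[t' [tt' t'c]]] := desc_strict isT valid_cons tc.
      by case: (child_clos_sep _ dx tx); rewrite E.
    exact: (desc_clos_sep tt' (desc_trans t'c (child_desc cd)) dx tx).
  rewrite separatorC separator_child // => /sep_clos cx.
  have [E|[t' [tt' t'c]]] := desc_strict isT valid_cons tc.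
    by case: ndc; rewrite -E; congr pair; rewrite E in st; apply: child_inj st dc.
  exact: (desc_clos_sep tt' t'c cx tx).
case/orP: ab => [ab|ba].
  by rewrite (separator_child ab); apply: key ab bc n2.
rewrite separatorC (separator_child ba); apply: key ba ac _ => -[E1 E2].
by apply: n1; rewrite E1 E2.
Qed.

Lemma decomposition_cofinal : U !=set0 -> covers_cofinally D U.
Proof.
move=> U0 t; have [u [tu Uu]] : dom t `&` U !=set0.
  have [->|/(parent_exists valid_cons)[s st]] := pselect (t = rt).
    by case: U0 => u Uu; exists u.
  exact: child_meets_U st.
have [t' tt' t'u] := part_below tu; exists t'; last by exists u.
exact/(on_path_root isT valid_cons).
Qed.

(** * Orientations of the tree edges by an end *)

Lemma child_ndesc s t : child s t -> ~ desc t s.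
Proof. by move=> /child_size st /size_suffix; rewrite st ltnn. Qed.

Lemma side_child (s t : D) : child s t -> side s t = desc t.
Proof.
move=> st; apply: side_eq => [u v tu ntv uv|||].
- by have [-> vt] := desc_cross tu ntv uv; split=> //; apply: child_inj vt st.
- exact: desc_refl.
- exact: child_ndesc.
- exact: (conn_desc isT valid_cons).
Qed.

Lemma side_parent (s t : D) : child s t -> side t s = ~` desc t.
Proof.
move=> st; have c u : ~ desc t u -> conn (~` desc t) rt u.
  elim/tree_ind: u => [|u v uv IH] nt; first exact: conn_refl.
  have ntu : ~ desc t u by move=> tu; apply: nt; apply: desc_trans tu (child_desc uv).
  apply: conn_trans (IH ntu) (conn_edge ntu nt _); by apply/orP; left.
apply: side_eq => [u v ntu /contrapT tv uv|||].
- have vu : node_adj v u by rewrite node_adj_sym.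
  by have [-> ut] := desc_cross tv ntu vu; split=> //; apply: child_inj ut st.
- exact: child_ndesc.
- by apply; apply: desc_refl.
- by move=> u ntu; apply: conn_trans (conn_sym (c s (child_ndesc st))) (c u ntu).
Qed.

Definition inside (w : set (nat -> G)) s := exists2 R, w R & has_tail_in R (dom s).

Section InsideEnd.
Variable w : set (nat -> G).
Hypothesis wE : ends G w.

Lemma inside_tail s R : inside w s -> w R -> has_tail_in R (dom s).
Proof. by move=> [S wS St] wR; apply: end_tail wE wS wR (nbh_dom_finite s) St. Qed.

Lemma not_inside_tail s R : ~ inside w s -> w R -> has_tail_in R (~` dom s).
Proof.
move=> ns wR; have [Rs|//] := ray_dichotomy (end_ray wE wR) (nbh_dom_finite s).
by case: ns; exists R.
Qed.

Lemma inside_root : inside w rt.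
Proof. by have [R wR] := end_inhabited wE; exists R => //; exists 0%N. Qed.

Lemma inside_desc s t : desc s t -> inside w t -> inside w s.
Proof. by move=> st [R wR Rt]; exists R => //; apply: has_tail_sub Rt; apply: desc_dom. Qed.

Lemma inside_common s t : inside w s -> inside w t -> exists x, dom s x /\ dom t x.
Proof.
move=> ws wt; have [R wR] := end_inhabited wE.
have [n [sn tn]] := has_tail_nonempty (has_tailI (inside_tail ws wR) (inside_tail wt wR)).
by exists (R n).
Qed.

Lemma inside_size_inj s t :
  inside w s -> inside w t -> size (val s) = size (val t) -> s = t.
Proof. by move=> ws wt; have [x [sx tx]] := inside_common ws wt; apply: dom_size_inj sx tx. Qed.

Lemma orients_child (s t : D) : child s t -> inside w t -> orients w s t.
Proof.
move=> st wt R wR; rewrite separator_child // side_child //.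
apply: has_tail_sub (has_tailI (inside_tail wt wR)
  (ray_avoids_finite (end_ray wE wR) (sep_finite t))) => x [tx ntx].
by split=> //; have [u tu ux] := part_below tx; exists u.
Qed.

Lemma orients_parent (s t : D) : child s t -> ~ inside w t -> orients w t s.
Proof.
move=> st nwt R wR; rewrite separatorC separator_child // side_parent //.
apply: has_tail_sub (has_tailI (not_inside_tail nwt wR)
  (ray_avoids_finite (end_ray wE wR) (sep_finite t))) => x [ntx nsx].
split=> //; have [u _ ux] := part_below (I : dom rt x); exists u => // tu.
by case: (desc_clos tu ux.1) => // /nbh_sep.
Qed.

Lemma lives_at_last (s : D) : inside w s -> (forall t, child s t -> ~ inside w t) ->
  lives_at w s.
Proof.
move=> ws nws x y /orP[xy|yx].
  by rewrite side_child // => ys; apply: orients_child xy (inside_desc ys ws).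
rewrite side_parent // => nxs; apply: orients_parent yx _ => wx.
have [z [sz xz]] := inside_common ws wx.
have [sx|//] := dom_comparable sz xz.
have [E|[t [st tx]]] := desc_strict isT valid_cons sx.
  by apply: nxs; rewrite E; apply: desc_refl.
exact: nws st (inside_desc tx wx).
Qed.

Definition branch_end (b : nat -> T) : set (nat -> T) :=
  [set S | is_ray S /\ ray_equiv b S].

Lemma branch_endE b : is_branch isT b -> ends T (branch_end b).
Proof. by move/branch_ray; apply: end_of_ray. Qed.

Lemma branch_end_in b : is_branch isT b -> branch_end b b.
Proof. by move/branch_ray => bray; split=> //; apply: ray_equiv_refl. Qed.

Lemma inside_branch_corresponds b : is_branch isT b -> (forall n, inside w (b n)) ->
  corresponds_to (D := D) w (branch_end b).
Proof.
move=> bb wb; split; first exact: branch_endE.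
move=> x y /orP[xy|yx] /(_ b (branch_end_in bb)).
  rewrite side_child // => -[n /(_ n (leqnn n)) yb].
  by apply: orients_child xy (inside_desc yb (wb n)).
rewrite side_parent // => -[n bx]; apply: orients_parent yx _ => wx.
have E : b (size (val x)) = x.
  by apply: inside_size_inj (wb _) wx _; rewrite (branch_size _ bb).
apply: (bx (maxn n (size (val x)))); first exact: leq_maxl.
by rewrite -{1}E; apply: branch_desc bb _; apply: leq_maxr.
Qed.

(** Used for the injectivity of [tau]: the end of the tree determines a branch of domains in which
    [w] lives. *)
Lemma corresponds_inside h b : corresponds_to (D := D) w h -> is_branch isT b -> h b ->
  forall n, inside w (b n).
Proof.
move=> [hE orw] bb hb [|n]; first by rewrite bb.1; apply: inside_root.
have [R wR] := end_inhabited wE; exists R => //.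
have bS := bb.2 n.
have := orw (b n) (b n.+1) _ _ R wR; rewrite separator_child // side_child //.
move=> H; have {H} := H _ _; case=> [||N RN].
- by apply/orP; left.
- move=> S hS; apply: end_tail hE hb hS (nbh_desc_finite _) _.
  by exists n.+1 => k; apply: branch_desc.
- exists N => k /RN[[u bu [ku _]] nsk].
  by case: (desc_clos bu ku) => // /nbh_sep.
Qed.

Lemma branch_or_last :
  (exists b, is_branch isT b /\ forall n, inside w (b n)) \/
  (exists s, inside w s /\ forall t, child s t -> ~ inside w t).
Proof.
have [|nl] := pselect (exists s, inside w s /\ forall t, child s t -> ~ inside w t).
  by right.
left; have /choice[f fP] s : exists t, inside w s -> child s t /\ inside w t.
  have [ws|] := pselect (inside w s); last by exists s.
  apply: contrapT => nt; apply: nl; exists s; split=> // t st wt.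
  by apply: nt; exists t.
have wf n : inside w (iter n f rt).
  by elim: n => [|n IH]; [apply: inside_root | case: (fP _ IH)].
exists (fun n => iter n f rt); split=> //; split=> // n.
by case: (fP _ (wf n)).
Qed.

(** Some member [E] of the family contains a tail of the spine. As its neighbourhood is finite,
    almost all teeth lie in [E], which therefore meets [U] and belongs to a child. *)
Lemma closure_not_last s : ends_in_closure U w -> inside w s ->
  exists t, child s t /\ inside w t.
Proof.
move=> [_ [R [P [[combR PU] wR]]]] ws.
have Rs := inside_tail ws wR; have [Rray infP _ _ _] := combR.
have [famP _ /(_ R Rray Rs)[E famE RE]] := dom_family s.
have [_ _ fE _] := famP E famE.
suff EU : E `&` U !=set0.
  by have [t [st tE]] := kid_child (conj famE EU); exists t; split=> //; exists R; rewrite ?tE.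
apply: contrapT => nEU; apply: infP.
apply: sub_finite_set (comb_teeth_almost_in combR fE RE) => q Pq; split=> // Eq.
by apply: nEU; exists (path_end q); split=> //; apply: PU; exists q.
Qed.

End InsideEnd.

(** * Ends along a branch of the tree *)

Lemma branch_avoids b X : is_branch isT b -> finite_set X ->
  exists n, forall m, (n <= m)%N -> forall x, X x -> ~ clos (dom (b m)) x.
Proof.
(* Domains from level [n.+1] on avoid [X]; one more level is needed for their closures. *)
move=> bb /dom_bounded_set[n nP]; exists n.+2 => -[//|m] nm x Xx /(child_clos (bb.2 m)) bx.
have : (size (val (b m)) <= n)%N by apply: nP; exists x.
by rewrite (branch_size _ bb) leqNgt -ltnS nm.
Qed.

(** Both rays meet the separator of a domain far along the branch, and this separator is connected
    and avoids [X]. *)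
Lemma branch_end_unique b R S : is_branch isT b -> is_ray R -> is_ray S ->
  (forall n, has_tail_in R (dom (b n))) -> (forall n, has_tail_in S (dom (b n))) ->
  ray_equiv R S.
Proof.
move=> bb Rray Sray Rb Sb; apply/ray_equivP => X fX.
(* The first vertices are added to [X] so that both rays start outside [dom (b n)] and have to enter
   it. *)
have [|n nP] := branch_avoids (X := X `|` [set R 0%N; S 0%N]) bb.
  by rewrite !finite_setU; do !split.
have meets Q : is_ray Q -> (forall n, has_tail_in Q (dom (b n))) ->
    ~ clos (dom (b n)) (Q 0%N) -> exists k, sep (b n) (Q k).
  move=> Qray /(_ n) /has_tail_nonempty[k Qk] Q0.
  have c : conn (range Q) (Q 0%N) (Q k).
    by apply: (ray_conn (N := 0)) => // i _; exists i.
  have nQ0 : ~ dom (b n) (Q 0%N) by move=> h; apply: Q0; left.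
  by have [z [i _ <-] /nbh_sep] := conn_meets_nbh c nQ0 Qk; exists i.
have [i Ri] : exists k, sep (b n) (R k).
  by apply: meets => //; apply: (nP n) => //; right; left.
have [j Sj] : exists k, sep (b n) (S k).
  by apply: meets => //; apply: (nP n) => //; right; right.
exists i, j; have /connected_inP[_ /(_ _ _ Ri Sj)] := sep_connected (b n).
by apply: conn_sub => x /sep_clos bx Xx; apply: (nP n (leqnn n) x _ bx); left.
Qed.

(** A finite connected set [Y] in the closure at level [n] contains [sep (b n)] and a vertex of [U];
    it avoids a later closure. Take its component after removing the later closure. As the first
    closure is connected, an edge leads from this component to the removed set, and it can only end
    in [sep (b m)]. *)
Lemma branch_block b n : is_branch isT b -> exists m F,
  [/\ (n < m)%N, connected_in F, F `<=` clos (dom (b n)),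
      forall x, F x -> ~ clos (dom (b m)) x &
      [/\ sep (b n) `<=` F, F `&` U !=set0 &
          exists x y, [/\ F x, sep (b m) y & adj G x y]]].
Proof.
move=> bb; have [u [u1 Uu]] := child_meets_U (bb.2 n).
have bu : dom (b n) u by apply: child_dom u1; apply: bb.2.
have cclos := clos_connected (dom_connected (b n)).
have [||Y [fY cY sY Yb]] := @connected_hull _ _ (sep (b n) `|` [set u]) cclos.
- by move=> x [/sep_clos//|->]; left.
- by rewrite finite_setU; split=> //; apply: sep_finite.
have [m' m'P] := branch_avoids bb fY; pose m := maxn m' n.+1.
have mP : forall x, Y x -> ~ clos (dom (b m)) x by apply: m'P; apply: leq_maxl.
have /connected_inP[[a na] _] := sep_connected (b n).
have /connected_inP[[c mc] _] := sep_connected (b m).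
have Ya : Y a by apply: sY; left.
have bnm : desc (b n) (b m) by apply: branch_desc bb _; rewrite leq_max leqnSn orbT.
have cb : clos (dom (b n)) c by apply: desc_clos bnm _ (sep_clos mc).
pose A := clos (dom (b n)) `\` clos (dom (b m)).
have YF : Y `<=` comp A a.
  move=> x Yx; have /connected_inP[_ /(_ a x Ya Yx)] := cY.
  by apply: conn_sub => y Yy; split; [apply: Yb | apply: mP].
exists m, (comp A a); split.
- exact: leq_maxr.
- by apply: comp_connected; apply: comp_sub (YF a Ya).
- by move=> x /comp_sub[].
- by move=> x /comp_sub[].
split; [|by exists u; split=> //; apply/YF/sY; right|].
  by move=> x nx; apply/YF/sY; left.
have /connected_inP[_ /(_ c a cb (Yb a Ya)) cca] := cclos.
have [|z bz nz] := conn_meets_nbh cca _ (YF a Ya).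
  by move=> /comp_sub[_]; apply; apply: sep_clos.
have nAz := nbh_comp nz; have [_ [x Fx xz]] := nz; have [_ nmx] := comp_sub Fx.
exists x, z; split=> //; have mz : clos (dom (b m)) z.
  by apply: contrapT => nmz; apply: nAz.
case: mz => [mz|/nbh_sep//]; case: nmx.
have [mx|nmx] := pselect (dom (b m) x); first by left.
by right; split=> //; exists z; rewrite // adj_sym.
Qed.

(** Blocks between suitable levels of the branch, each joined to the separator with which the next
    begins, yield a comb attached to [U]. Its spine is eventually in every domain of the branch. *)
Lemma branch_closure_end b : is_branch isT b ->
  exists2 w, ends_in_closure U w & forall n, inside w (b n).
Proof.
move=> bb; have /choice[f fP] n : exists p : nat * set G,
  [/\ (n < p.1)%N, connected_in p.2, p.2 `<=` clos (dom (b n)),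
      forall x, p.2 x -> ~ clos (dom (b p.1)) x &
      [/\ sep (b n) `<=` p.2, p.2 `&` U !=set0 &
          exists x y, [/\ p.2 x, sep (b p.1) y & adj G x y]]].
  by have [m [F H]] := branch_block n bb; exists (m, F).
pose k i := iter i (fun n => (f n).1) 0%N.
pose F i := (f (k i)).2.
have kS i : (k i < k i.+1)%N by case: (fP (k i)).
have kle i j : (i <= j)%N -> (k i <= k j)%N.
  elim: j => [|j IH]; first by rewrite leqn0 => /eqP->.
  by rewrite leq_eqVlt => /predU1P[->//|/IH ij]; apply: leq_trans ij (ltnW (kS j)).
have ik i : (i <= k i)%N by elim: i => // i IH; apply: leq_ltn_trans IH (kS i).
have Fb i j : (i <= j)%N -> F j `<=` clos (dom (b (k i))).
  move=> ij x Fx; apply: (desc_clos (branch_desc bb (kle _ _ ij))).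
  by case: (fP (k j)) => _ _ Fsub _ _; apply: Fsub.
have disj i j x : (i < j)%N -> F i x -> ~ F j x.
  by move=> ij Fi /(Fb i.+1 j ij); case: (fP (k i)) => _ _ _ nb _; apply: nb.
have /choice[u uP] i : exists u, F i u /\ U u.
  by case: (fP (k i)) => _ _ _ _ [_ [u uP] _]; exists u.
have [||||R [P [combR Pu RF]]] := @comb_of_blocks _ F u.
- by move=> i; case: (fP (k i)).
- move=> i j x Fi Fj; apply/eqP; rewrite eqn_leq; apply/andP.
  by split; rewrite leqNgt; apply/negP => /disj; [move/(_ x Fj) | move/(_ x Fi)].
- move=> i; case: (fP (k i)) => _ _ _ _ [_ _ [x [y [Fx sy xy]]]].
  by exists x, y; split=> //; case: (fP (k i.+1)) => _ _ _ _ [sF _ _]; apply: sF.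
- by move=> i; case: (uP i).
have Rray : is_ray R by case: combR.
pose w := [set S | is_ray S /\ ray_equiv R S].
have wR : w R by split=> //; apply: ray_equiv_refl.
exists w; first split.
- exact: end_of_ray.
- by exists R, P; split=> //; split=> //; rewrite Pu => _ [i _ <-]; case: (uP i).
move=> n; exists R => //; apply: has_tail_sub (RF n.+1) => x [i /= ni /(Fb _ _ ni)].
move=> /(desc_clos (branch_desc bb (ik n.+1))); apply: child_clos; exact: bb.2.
Qed.

Lemma decomposition_displays : displays D (ends_in_closure U).
Proof.
(* An end goes to a last node in whose domain it lives or, if there is none, to the end of a branch
   of such nodes. *)
have /choice[tau tauP] w : exists tau : D + set (nat -> D), ends G w ->
    match tau with
    | inl s => inside w s /\ forall t, child s t -> ~ inside w t
    | inr h => exists b, [/\ is_branch isT b, forall n, inside w (b n) &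
                 h = branch_end b]
    end.
  have [wE|] := pselect (ends G w); last by exists (inl rt).
  have [[b [bb wb]]|[s sP]] := branch_or_last wE; last by exists (inl s).
  by exists (inr (branch_end b)) => _; exists b.
have tau_end w : ends_in_closure U w -> exists b, [/\ is_branch isT b,
    forall n, inside w (b n) & tau w = inr (branch_end b)].
  move=> wU; have wE := wU.1; have := tauP w wE.
  case: (tau w) => [s [ws ns]|h [b [bb wb ->]]]; last by exists b.
  by have [t [st wt]] := closure_not_last wE wU ws; case: (ns t).
have tauT : is_tau tau.
  move=> w wE; have := tauP w wE; case: (tau w) => [s []|h [b [bb wb ->]]].
    exact: lives_at_last.
  exact: inside_branch_corresponds.
have uniq b w w' : is_branch isT b -> ends G w -> ends G w' ->
    (forall n, inside w (b n)) -> (forall n, inside w' (b n)) -> w = w'.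
  move=> bb wE w'E wb w'b.
  have [[R wR] [R' w'R']] := (end_inhabited wE, end_inhabited w'E).
  apply: (end_eq wE w'E wR w'R'); apply: (branch_end_unique bb).
  - exact: end_ray wE wR.
  - exact: end_ray w'E w'R'.
  - by move=> n; apply: inside_tail wE _ _ (wb n) wR.
  - by move=> n; apply: inside_tail w'E _ _ (w'b n) w'R'.
exists tau; split=> //; first split.
- move=> w /tau_end[b [bb _ ->]]; exists (branch_end b) => //; exact: branch_endE.
- move=> w w' /set_mem wU /set_mem w'U E.
  have [b [bb wb tw]] := tau_end w wU.
  apply: (uniq b) => //; [exact: wU.1 | exact: w'U.1 |].
  have := tauT w' w'U.1; rewrite -E tw /= => c n.
  exact: (corresponds_inside w'U.1 c bb (branch_end_in bb) n).
- move=> _ [h hE <-]; have [S hS] := end_inhabited hE.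
  have [b [bb bS]] := ray_branch isT valid_cons (end_ray hE hS).
  have [w wU wb] := branch_closure_end bb; exists w => //.
  have [b' [b'b wb' ->]] := tau_end w wU; congr inr.
  have -> : b' = b.
    apply: funext => n; apply: (inside_size_inj wU.1 (wb' n) (wb n)).
    by rewrite !(branch_size _ _).
  exact: end_eq (branch_endE bb) hE (branch_end_in bb) hS bS.
(* An end mapped to a branch equals the end in the closure of [U] found along that branch. *)
- move=> w wE nU; have := tauP w wE; case: (tau w) => [s _|h [b [bb wb _]]].
    by exists s.
  have [w' w'U w'b] := branch_closure_end bb.
  by case: nU; rewrite (uniq b w w' bb wE w'U.1 wb w'b).
Qed.

End Construction.

(* [U !=set0] is needed for the last conjunct only: a tree has a root, so no
   rooted tree-decomposition covers the empty set cofinally. *)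
Theorem theorem3p5 (G : graph) (U : set G) (Gconn : connected_graph G) :
  ((has_dominated_comb U \/
      exists D : rooted_tree_decomposition G, displaying_decomposition U D) /\
   ~ (has_dominated_comb U /\
      exists D : rooted_tree_decomposition G, displaying_decomposition U D)) /\
  ((exists D : rooted_tree_decomposition G, displaying_decomposition U D) ->
   exists D : rooted_tree_decomposition G,
     [/\ displaying_decomposition U D,
         connected_separators D
       & U !=set0 -> covers_cofinally D U]).
Proof.
have construct : ~ has_dominated_comb U -> exists D : rooted_tree_decomposition G,
    [/\ displaying_decomposition U D, connected_separators D
      & U !=set0 -> covers_cofinally D U].
  move=> undom.
  (* For a set that is not connected or has an infinite neighbourhood the value is arbitrary; no
     node has such a domain. *)
  have /choice[f fP] C : exists p : set G * set (set G),
      connected_in C -> finite_set (nbh C) ->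
      [/\ finite_set p.1, connected_in p.1, nbh C `<=` p.1, p.1 `<=` clos C &
          separating_family U p.1 C p.2].
    have [[cC fC]|nC] := pselect (connected_in C /\ finite_set (nbh C)); last first.
      by exists (set0, set0) => cC fC; case: nC.
    have nC : nbh C `<=` clos C by move=> x; right.
    have [X [fX cX nX XC]] := connected_hull (clos_connected cC) nC fC.
    have [FF FFP] := separating_family_exists fX undom cC fC.
    by exists (X, FF).
  exists (decomposition Gconn fP); split; first split.
  - exact: decomposition_finite.
  - exact: decomposition_disjoint.
  - exact: decomposition_displays.
  - exact: decomposition_connected.
  - exact: decomposition_cofinal.
split; first split.
- have [?|/construct[D [? _ _]]] := pselect (has_dominated_comb U); first by left.
  by right; exists D.
- by move=> [dom [D /displayed_end_undominated]]; apply.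
(* The given decomposition only serves to exclude dominated combs; a new one is then constructed. *)
- by move=> [D /displayed_end_undominated]; exact: construct.
Qed.
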